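(* Let $\phi:\mathbb{R}^d\to\mathbb{R}$ be a convex quadratic function with Hessian $A\in\mathbb{R}^{d\times d}$, i.e. $\phi(\mathbf{y})=\phi(\mathbf{x})+\langle\nabla\phi(\mathbf{x}),\mathbf{y}-\mathbf{x}\rangle+\frac12\|\mathbf{y}-\mathbf{x}\|_A^2$ for all $\mathbf{x},\mathbf{y}$, with $0\preceq A\preceq L\cdot I$, $L>0$, and let $\phi$ be $\mu$-strongly convex, $\mu>0$, with minimizer $\mathbf{x}^*$. Let $f=\phi+\zeta$ with $|f(\mathbf{x})-\phi(\mathbf{x})|\le\sigma$ for all $\mathbf{x}$, $\sigma\ge0$. Let $\alpha>0$, and for $t=0,\dots,T-1$ let $S_t\in\mathbb{R}^{d\times\ell}$ be a $(\frac14,k,\frac{\delta}{T})$-oblivious sketching matrix for the matrix product, with columns $\mathbf{s}_t^{(i)}$ and with $\ell=\mathcal{O}\left(k+\log\frac{T}{\delta}\right)$; assume $k>\log\frac{T}{\delta}$. Let $H_t\in\mathbb{R}^{d\times d}$ be symmetric positive definite with $\rho_tH_t\preceq A$, $\rho_t>0$, and denote $\rho=\min_t\rho_t\neq0$. Let $$\mathbf{x}_{t+1}=\mathbf{x}_t-\eta_t\sum_{i=1}^{\ell}\frac{f(\mathbf{x}_t+\alpha H_t^{-1/2}\mathbf{s}_t^{(i)})-f(\mathbf{x}_t-\alpha H_t^{-1/2}\mathbf{s}_t^{(i)})}{2\alpha}\,H_t^{-1/2}\mathbf{s}_t^{(i)},$$ with $\eta_t=\left(5\|H_t^{-1/2}AH_t^{-1/2}\|_2+\frac{\mathrm{tr}(H_t^{-1}A)}{k}\right)^{-1}$.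 Then, to obtain $\mathbf{x}_T$ such that $\phi(\mathbf{x}_T)-\phi(\mathbf{x}^* )\le\epsilon+\frac{3\ell\sigma^2}{\rho\alpha^2}$ with probability $1-\delta$, it suffices to take a number of iterations $$T=\mathcal{O}\left(\max_t\left\{\rho_t^{-1}\left(\|H_t^{-1/2}AH_t^{-1/2}\|_2+\frac{\mathrm{tr}(H_t^{-1}A)}{k}\right)\right\}\log\frac1\epsilon\right),$$ and accordingly the query complexity $Q=T\times\ell$ is $$Q=\tilde{\mathcal{O}}\left(\max_t\left\{\rho_t^{-1}\left(\|H_t^{-1/2}AH_t^{-1/2}\|_2\cdot\ell+\mathrm{tr}(H_t^{-1}A)\right)\right\}\log\frac1\epsilon\right).$$
   Context: Norms: $\|\mathbf{x}\|$ is Euclidean, $\|\mathbf{x}\|_A=\|A^{1/2}\mathbf{x}\|$, $\|\cdot\|_2$ spectral, $\|\cdot\|_F$ Frobenius; $B\preceq C$ means $C-B$ is positive semidefinite. $\mu$-strong convexity: $\phi(\mathbf{y})\ge\phi(\mathbf{x})+\langle\nabla\phi(\mathbf{x}),\mathbf{y}-\mathbf{x}\rangle+\frac{\mu}{2}\|\mathbf{y}-\mathbf{x}\|^2$ for all $\mathbf{x},\mathbf{y}$. Sketching matrix: for $0<\gamma\le1$, $k\ge1$, $\delta>0$, a random matrix $S\in\mathbb{R}^{d\times\ell}$ is an oblivious $(\gamma,k,\delta)$-random sketching matrix for the matrix product if, for any given matrix $B\in\mathbb{R}^{d\times d}$ ($S$ being independent of $B$), with probability at least $1-\delta$, $\|B^\top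 SS^\top B-B^\top B\|_2\le\gamma\left(\|B\|_2^2+\frac{\|B\|_F^2}{k}\right)$. The matrix $S_t$ is freshly generated at iteration $t$, independently of $\mathbf{x}_t$ and $H_t$. Conventions: the $\mathcal{O}(\cdot)$ for $T$ treats the initial gap $\phi(\mathbf{x}_0)-\phi(\mathbf{x}^* )$ as a constant inside the logarithm; $\tilde{\mathcal{O}}(\cdot)$ hides constant and $\log\log\frac1\epsilon$ terms. Query complexity is counted as $T\times\ell$ (up to constants, the number of evaluations of $f$). *)

(* Defs.v *)
From mathcomp Require Import all_boot all_order all_algebra.
From mathcomp Require Import all_classical all_reals all_analysis.

Set Implicit Arguments.
Unset Strict Implicit.
Unset Printing Implicit Defensive.

Import Order.TTheory GRing.Theory Num.Theory.
Import numFieldNormedType.Exports.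

Local Open Scope classical_set_scope.
Local Open Scope ring_scope.

Section LinearAlgebra.
Variable R : realType.

Definition dotv n (u v : 'cV[R]_n) : R := (u^T *m v) 0 0.

Definition l2norm n (u : 'cV[R]_n) : R := Num.sqrt (dotv u u).

Definition specnorm m n (B : 'M[R]_(m, n)) : R :=
  sup [set l2norm (B *m u) | u in [set u : 'cV[R]_n | l2norm u <= 1]].

Definition frobnorm m n (B : 'M[R]_(m, n)) : R :=
  Num.sqrt (\sum_i \sum_j B i j ^+ 2).

Definition psdmx n (B : 'M[R]_n) : Prop :=
  B^T = B /\ forall u : 'cV[R]_n, 0 <= dotv u (B *m u).

Definition posdefmx n (B : 'M[R]_n) : Prop :=
  B^T = B /\ forall u : 'cV[R]_n, u != 0 -> 0 < dotv u (B *m u).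

Definition loewner n (B C : 'M[R]_n) : Prop := psdmx (C - B).

(* The positive semidefinite square root; for B not positive semidefinite the
   set below is empty and the value is the default 0. *)
Definition sqrtmx n (B : 'M[R]_n) : 'M[R]_n :=
  xget 0 [set W : 'M[R]_n | psdmx W /\ W *m W = B].

Definition invsqrtmx n (B : 'M[R]_n) : 'M[R]_n := invmx (sqrtmx B).

Definition mxnorm n (A : 'M[R]_n) (u : 'cV[R]_n) : R := l2norm (sqrtmx A *m u).

End LinearAlgebra.

Section Functions.
Variables (R : realType) (d : nat).
Implicit Types (phi f : 'cV[R]_d -> R) (x : 'cV[R]_d).

(* Under [quadratic_with_hessian] below phi is a polynomial of degree at most 2,
   hence differentiable, so these partial derivatives are genuine. *)
Definition grad phi x : 'cV[R]_d :=
  \col_i 'D_(delta_mx i 0) (phi : 'cV[R]_d -> R^o) x.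

Definition quadratic_with_hessian phi (A : 'M[R]_d) : Prop :=
  forall x y, phi y = phi x + dotv (grad phi x) (y - x)
                      + 2^-1 * mxnorm A (y - x) ^+ 2.

Definition strongly_convex phi (mu : R) : Prop :=
  forall x y, phi x + dotv (grad phi x) (y - x) + mu / 2 * l2norm (y - x) ^+ 2
              <= phi y.

Definition minimizer phi x : Prop := forall y, phi x <= phi y.

End Functions.

Section Algorithm.
Variables (R : realType) (d l : nat).
Implicit Types (f : 'cV[R]_d -> R) (A H W : 'M[R]_d) (S : 'M[R]_(d, l)).

Definition scaled_hessian A H : 'M[R]_d := invsqrtmx H *m A *m invsqrtmx H.

Definition step_size A H (k : R) : R :=
  (5 * specnorm (scaled_hessian A H) + \tr (invmx H *m A) / k)^-1.

Definition central_diff f (alpha : R) (x v : 'cV[R]_d) : R :=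
  (f (x + alpha *: v) - f (x - alpha *: v)) / (2 * alpha).

Definition zo_step f A (alpha k : R) H S (x : 'cV[R]_d) : 'cV[R]_d :=
  x - step_size A H k *:
      \sum_(i < l) let v := invsqrtmx H *m col i S in
                   central_diff f alpha x v *: v.

Fixpoint zo_iter f A (alpha k : R) (H : nat -> 'M[R]_d)
    (S : nat -> 'M[R]_(d, l)) (x0 : 'cV[R]_d) (t : nat) : 'cV[R]_d :=
  if t is t'.+1 then
    zo_step f A alpha k (H t') (S t') (zo_iter f A alpha k H S x0 t')
  else x0.

End Algorithm.

Section Probability.
Context {R : realType} {disp : measure_display} {Omega : measurableType disp}.
Variable P : probability Omega R.

(* Q itself need not be measurable; when it is, this is p <= P Q. *)
Definition with_prob (p : R) (Q : set Omega) : Prop :=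
  exists E : set Omega, [/\ measurable E, (p%:E <= P E)%E & E `<=` Q].

Definition random_mx m n (X : Omega -> 'M[R]_(m, n)) : Prop :=
  forall i j, measurable_fun setT (fun w => X w i j).

Definition sigma_mx m n (X : Omega -> 'M[R]_(m, n)) : set (set Omega) :=
  <<s [set E | exists i j, exists2 U : set R,
                 measurable U & E = [set w | U (X w i j)]] >>.

Definition indep_mx m n m' n' (X : Omega -> 'M[R]_(m, n))
    (Y : Omega -> 'M[R]_(m', n')) : Prop :=
  forall E F : set Omega, sigma_mx X E -> sigma_mx Y F ->
    P (E `&` F) = (P E * P F)%E.

Definition sketching_mx d l (S : Omega -> 'M[R]_(d, l)) (gamma k delta : R) :
    Prop :=
  random_mx S /\
  forall B : 'M[R]_d, with_prob (1 - delta)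
    [set w | specnorm (B^T *m S w *m (S w)^T *m B - B^T *m B)
             <= gamma * (specnorm B ^+ 2 + frobnorm B ^+ 2 / k)].

End Probability.

(* Extrema of F over {0, ..., T - 1}, for T > 0. *)
Definition max_upto (R : realType) (T : nat) (F : nat -> R) : R :=
  \big[Num.max/F 0%N]_(t < T) F t.

Definition min_upto (R : realType) (T : nat) (F : nat -> R) : R :=
  \big[Num.min/F 0%N]_(t < T) F t.

(* Main.v *)
Require Import Defs.
From mathcomp Require Import all_boot all_order all_algebra.
From mathcomp Require Import all_classical all_reals all_analysis.
From mathcomp Require Import measurable_realfun.
From mathcomp Require Import ring lra.
From mathcomp.real_closed Require Import complex.

Set Implicit Arguments.
Unset Strict Implicit.
Unset Printing Implicit Defensive.

Import Order.TTheory GRing.Theory Num.Theory.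
Import numFieldNormedType.Exports.

Local Open Scope classical_set_scope.
Local Open Scope ring_scope.

(** The iteration is analysed in the metric of [H_t].  Put
    [M = H^{-1/2} A H^{-1/2}], [p = x - xstar], [g = H^{-1/2} A p],
    [a = specnorm M] and [tau = tr M / k].  As [phi] is quadratic, its central
    differences are the exact directional derivatives [S^T g], and the noise adds
    to them a vector [e] with [|e|^2 <= l sigma^2 / alpha^2].  If
      - [(S c)^T M (S c) <= (2 a + tau) |c|^2] for all [c], and
      - [|S^T g|^2 >= |g|^2 / 6],
    then, as the step size [eta] is [1 / (5 a + tau)], one step turns the gap
    [D = phi x - phi xstar] into at most
    [(1 - eta rho / 6) D + eta / 2 |e|^2] ([zo_step_gap], with the
    Polyak-Lojasiewicz inequality [gap_le]).  Iterating gives the geometric decay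
    at rate [1 / (30 kappa)] and the noise floor
    [3 l sigma^2 / (rho alpha^2)] ([zo_iter_gap]).

    Both properties have to come from a single application of the sketching
    guarantee: each application fails with probability [delta / T], so two per
    step would only give [1 - 2 delta].  This is achieved by the test matrix
    [B = (M + c g g^T / |g|^2)^{1/2}] with [c = (a + tau) / 2].  The guarantee
    compares [|S^T B z|^2] with [|B z|^2] up to
    [eps |z|^2], where [eps <= (a + c + tau + c / k) / 4], that is
    [eps <= (3/4 + 1/(4 k)) c].  Since [B^2] dominates [M], the first property
    follows from [a + c + eps <= 2 a + tau] ([sketch_quad_le]); the choice
    [z = B^{-1} g], for which [|z|^2 <= |g|^2 / c], gives the second one as soon
    as [k >= 3] ([sketch_grad_ge]).  That [k] is large is automatic, because
    [k > ln (T / delta)] and [T] is at least a multiple of [ln (1 / eps)].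

    The guarantee concerns a fixed matrix whereas [B] depends on [x_t] and
    [H_t], which are independent of [S_t].  The lemma [sketch_ok_random]
    transfers it by rounding [(x_t, H_t)] to finer and finer grids, and relies on
    the continuity of [B] as a function of [(x_t, H_t)] ([mxcvg_test]).  The
    latter amounts to the continuity of the square root of matrices
    ([sqrtmx_lipschitz]), whose existence comes from the spectral theorem
    ([psdmx_sqrt_exists]). *)

(** * Square roots of positive semidefinite matrices *)

Lemma poly_interpolation (F : fieldType) (s : seq F) (f : F -> F) :
  exists p : {poly F}, {in s, forall x, p.[x] = f x}.
Proof.
elim: s => [|y s [p pP]]; first by exists 0.
have [ys|ys] := boolP (y \in s).
  by exists p => x; rewrite inE => /predU1P[->|]; exact: pP.
pose q := \prod_(z <- s) ('X - z%:P).
have q0 : q.[y] != 0 by rewrite -[_ == _]/(root q y) root_prod_XsubC.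
exists (p + ((f y - p.[y]) / q.[y]) *: q) => x; rewrite inE !hornerE.
case/predU1P => [->|xs]; first by rewrite divfK// addrC subrK.
suff -> : q.[x] = 0 by rewrite mulr0 addr0; exact: pP.
by apply/eqP; rewrite -[_ == _]/(root q x) root_prod_XsubC.
Qed.

Section Sqrt.
Variable R : realType.

Lemma dotvE n (u v : 'cV[R]_n) : dotv u v = \sum_i u i 0 * v i 0.
Proof. by rewrite /dotv !mxE; apply: eq_bigr => i _; rewrite mxE. Qed.

Lemma dotvC n (u v : 'cV[R]_n) : dotv u v = dotv v u.
Proof. by rewrite !dotvE; apply: eq_bigr => i _; rewrite mulrC. Qed.

Lemma dotv_mulmx m n (u : 'cV[R]_m) (B : 'M[R]_(m, n)) (v : 'cV[R]_n) :
  dotv u (B *m v) = dotv (B^T *m u) v.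
Proof. by rewrite /dotv trmx_mul trmxK mulmxA. Qed.

Lemma dotvv_ge0 n (u : 'cV[R]_n) : 0 <= dotv u u.
Proof. by rewrite dotvE; apply: sumr_ge0 => i _; rewrite -expr2 sqr_ge0. Qed.

Lemma dotvv_eq0 n (u : 'cV[R]_n) : (dotv u u == 0) = (u == 0).
Proof.
rewrite dotvE psumr_eq0; last by move=> i _; rewrite -expr2 sqr_ge0.
apply/allP/eqP => [u0|-> i _]; last by rewrite mxE mulr0 eqxx.
apply/matrixP => i j; rewrite ord1 mxE.
by have := u0 i (mem_index_enum i); rewrite mulf_eq0 orbb => /eqP.
Qed.

Lemma horner_mx_sym n (H : 'M[R]_n.+1) (p : {poly R}) :
  H^T = H -> (horner_mx H p)^T = horner_mx H p.
Proof.
move=> Hs; elim/poly_ind: p => [|p c IH]; first by rewrite rmorph0 trmx0.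
rewrite rmorphD rmorphM /= horner_mx_X horner_mx_C linearD /= tr_scalar_mx.
congr (_ + _); rewrite -[LHS]/((_ *m _)^T) trmx_mul IH Hs.
by rewrite -[RHS]/(_ *m _); apply/esym/comm_horner_mx.
Qed.

(** A real symmetric [H] is diagonalizable over the complex numbers with real
    eigenvalues, which are nonnegative when [H] is.  A real polynomial [p] with
    [p(x)^4 = x] at every eigenvalue then satisfies [p(H)^4 = H], and [p(H)^2]
    is the root: taking a fourth root instead of a square root makes it the
    square of a symmetric matrix, hence visibly positive semidefinite. *)
Lemma psdmx_sqrt_exists n (H : 'M[R]_n) : psdmx H ->
  exists W : 'M[R]_n, psdmx W /\ W *m W = H.
Proof.
case: n H => [|n] H [Hs Hpsd].
  exists 0; split; last by rewrite mulmx0; apply/matrixP => -[].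
  by split=> [|u]; [rewrite trmx0|rewrite mul0mx /dotv mulmx0 mxE].
pose toC := real_complex R.
have HC : map_mx toC H \is hermsymmx.
  apply: realsym_hermsym.
    apply/is_hermitianmxP; rewrite expr0 scale1r map_mx_id//.
    by rewrite map_trmx Hs.
  by apply/mxOverP => i j; rewrite mxE; apply/complex_realP; eexists.
have /hermitian_normalmx/orthomx_spectralP := HC.
set U := spectralmx _; set D := spectral_diag _ => HE.
have Uu : U \in unitmx by exact: spectral_unit.
have Dreal : forall i, exists2 r : R, 0 <= r & D 0 i = toC r.
  move=> i.
  have /mxOverP/(_ 0 i)/complex_realP[r Dr] := hermitian_spectral_diag_real HC.
  exists r => //.
  (* The eigenvalue has a real eigenvector, since the characteristic
     polynomial of H is real. *)
  have /eigenvalueP[v vH v0] : eigenvalue H r.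
    rewrite eigenvalue_root_char -(fmorph_root toC) map_char_poly.
    rewrite -eigenvalue_root_char; apply/eigenvalueP.
    exists (row i U).
      by rewrite -row_mul HE !mulmxA mulmxV// mul1mx row_mul row_diag_mx -scalemxAl -rowE Dr.
    apply/eqP => /(congr1 (mulmx^~ (invmx U))).
    rewrite rowE mulmxK// mul0mx => /rowP/(_ i); rewrite !mxE !eqxx.
    by move/eqP; rewrite oner_eq0.
  have := Hpsd v^T.
  rewrite /dotv trmxK mulmxA vH -scalemxAl mxE.
  have := dotvv_ge0 v^T; rewrite /dotv trmxK le_eqVlt => /predU1P[v00|vv0].
    by move: v0; rewrite -trmx_eq0 -dotvv_eq0 /dotv trmxK -v00 eqxx.
  by rewrite pmulr_lge0.
pose lam i := complex.Re (D 0 i).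
have lamE i : D 0 i = toC (lam i).
  by have [r _ Dr] := Dreal i; rewrite /lam Dr.
have lam0 i : 0 <= lam i.
  by have [r r0 Dr] := Dreal i; rewrite /lam Dr.
have [p pP] := poly_interpolation [seq lam i | i : 'I_n.+1]
  (fun x => Num.sqrt (Num.sqrt x)).
have pE i : p.[lam i] ^+ 4 = lam i.
  rewrite pP ?map_f ?mem_enum//.
  by rewrite (exprM _ 2 2) !sqr_sqrtr ?sqrtr_ge0.
pose V := horner_mx H p.
have Vs : V^T = V by exact: horner_mx_sym.
have V4 : V ^+ 4 = H.
  apply: (@map_mx_inj _ _ toC); rewrite /V -rmorphXn/=.
  rewrite map_horner_mx HE horner_mx_uconjC//; congr (_ *m _ *m _).
  rewrite horner_mx_diag; congr diag_mx; apply/rowP => i; rewrite !mxE.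
  by rewrite lamE horner_map/= horner_exp pE.
exists (V *m V); split.
  split=> [|u]; first by rewrite trmx_mul Vs.
  by rewrite -mulmxA dotv_mulmx Vs dotvv_ge0.
by rewrite -[RHS]V4 !exprS expr0 mulr1 -!mulmxA.
Qed.
End Sqrt.

(** * Euclidean, spectral and Frobenius norms *)

Section LinAlg.
Variable R : realType.

Lemma dotvDl n (u v w : 'cV[R]_n) : dotv (u + v) w = dotv u w + dotv v w.
Proof. by rewrite /dotv linearD /= mulmxDl mxE. Qed.

Lemma dotvDr n (u v w : 'cV[R]_n) : dotv w (u + v) = dotv w u + dotv w v.
Proof. by rewrite /dotv mulmxDr mxE. Qed.

Lemma dotvZl n a (u w : 'cV[R]_n) : dotv (a *: u) w = a * dotv u w.
Proof. by rewrite /dotv linearZ /= -scalemxAl mxE. Qed.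

Lemma dotvZr n a (u w : 'cV[R]_n) : dotv w (a *: u) = a * dotv w u.
Proof. by rewrite /dotv -scalemxAr mxE. Qed.

Lemma dotvNl n (u w : 'cV[R]_n) : dotv (- u) w = - dotv u w.
Proof. by rewrite -scaleN1r dotvZl mulN1r. Qed.

Lemma dotvNr n (u w : 'cV[R]_n) : dotv w (- u) = - dotv w u.
Proof. by rewrite -scaleN1r dotvZr mulN1r. Qed.

Lemma dotv0l n (w : 'cV[R]_n) : dotv 0 w = 0.
Proof. by rewrite -(scale0r w) dotvZl mul0r. Qed.

Lemma dotv0r n (w : 'cV[R]_n) : dotv w 0 = 0.
Proof. by rewrite dotvC dotv0l. Qed.

Lemma cauchy_schwarz n (u v : 'cV[R]_n) :
  dotv u v ^+ 2 <= dotv u u * dotv v v.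
Proof.
have [->|v0] := eqVneq v 0; first by rewrite !dotv0r expr0n mulr0.
have vv : 0 < dotv v v by rewrite lt_neqAle eq_sym dotvv_eq0 v0 dotvv_ge0.
have := dotvv_ge0 (dotv v v *: u - dotv u v *: v).
rewrite !(dotvDl, dotvDr, dotvNl, dotvNr, dotvZl, dotvZr) (dotvC v u).
set a := dotv u u; set b := dotv u v; set c := dotv v v in vv *.
rewrite (_ : _ + _ = c * (a * c - b ^+ 2)); last by ring.
by rewrite pmulr_rge0// subr_ge0.
Qed.

Lemma l2norm_sq n (u : 'cV[R]_n) : l2norm u ^+ 2 = dotv u u.
Proof. by rewrite sqr_sqrtr ?dotvv_ge0. Qed.

Lemma l2norm_ge0 n (u : 'cV[R]_n) : 0 <= l2norm u.
Proof. exact: sqrtr_ge0. Qed.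

Lemma l2norm_le n (u : 'cV[R]_n) (c : R) :
  0 <= c -> (l2norm u <= c) = (dotv u u <= c ^+ 2).
Proof. by move=> c0; rewrite -l2norm_sq ler_sqr// nnegrE l2norm_ge0. Qed.

Lemma frobnorm_sq m n (B : 'M[R]_(m, n)) :
  frobnorm B ^+ 2 = \sum_i \sum_j B i j ^+ 2.
Proof.
by rewrite sqr_sqrtr//; do 2!(apply: sumr_ge0 => ? _); rewrite sqr_ge0.
Qed.

Lemma frobnorm_tr m n (B : 'M[R]_(m, n)) : frobnorm B ^+ 2 = \tr (B *m B^T).
Proof.
rewrite frobnorm_sq; apply: eq_bigr => i _; rewrite mxE.
by apply: eq_bigr => j _; rewrite mxE expr2.
Qed.

Lemma frobnorm_mul m n (B : 'M[R]_(m, n)) (u : 'cV[R]_n) :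
  dotv (B *m u) (B *m u) <= frobnorm B ^+ 2 * dotv u u.
Proof.
rewrite frobnorm_sq mulr_suml dotvE; apply: ler_sum => i _.
have -> : (B *m u) i 0 = dotv (row i B)^T u.
  by rewrite /dotv trmxK -row_mul [RHS]mxE.
rewrite -expr2; apply: le_trans (cauchy_schwarz _ _) _.
rewrite ler_wpM2r ?dotvv_ge0// dotvE.
by apply: ler_sum => j _; rewrite !mxE expr2.
Qed.

Lemma specnorm_has_sup m n (B : 'M[R]_(m, n)) :
  has_sup [set l2norm (B *m u) | u in [set u : 'cV[R]_n | l2norm u <= 1]].
Proof.
split.
  exists (l2norm (B *m 0)), 0 => //=.
  by rewrite /l2norm dotv0l sqrtr0 ler01.
exists (frobnorm B) => _ [u /= u1 <-].
rewrite l2norm_le ?sqrtr_ge0// (le_trans (frobnorm_mul _ _))//.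
by rewrite ler_piMr ?sqr_ge0// -(expr1n R 2) -l2norm_le.
Qed.

Lemma specnorm_ge0 m n (B : 'M[R]_(m, n)) : 0 <= specnorm B.
Proof.
apply: (le_trans (l2norm_ge0 (B *m 0))).
apply: (ub_le_sup (specnorm_has_sup B).2).
by exists 0 => //=; rewrite /l2norm dotv0l sqrtr0 ler01.
Qed.

Lemma specnorm_mul m n (B : 'M[R]_(m, n)) (u : 'cV[R]_n) :
  dotv (B *m u) (B *m u) <= specnorm B ^+ 2 * dotv u u.
Proof.
have [->|u0] := eqVneq u 0; first by rewrite mulmx0 !dotv0l mulr0.
have nu : 0 < l2norm u by rewrite sqrtr_gt0 lt_neqAle eq_sym dotvv_eq0 u0 dotvv_ge0.
rewrite -[dotv u u]l2norm_sq -exprMn -l2norm_le ?mulr_ge0 ?specnorm_ge0 ?l2norm_ge0//.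
rewrite -ler_pdivrMr//.
apply: (ub_le_sup (specnorm_has_sup B).2); exists ((l2norm u)^-1 *: u) => /=.
  rewrite l2norm_le// dotvZl dotvZr -l2norm_sq mulrA -expr2 -exprMn.
  by rewrite mulVf ?gt_eqF.
rewrite -scalemxAr /l2norm dotvZl dotvZr mulrA -expr2 sqrtrM ?sqr_ge0//.
by rewrite sqrtr_sqr ger0_norm ?invr_ge0 ?sqrtr_ge0// mulrC.
Qed.

Lemma specnorm_le m n (B : 'M[R]_(m, n)) (c : R) : 0 <= c ->
  (forall u, dotv (B *m u) (B *m u) <= c ^+ 2 * dotv u u) -> specnorm B <= c.
Proof.
move=> c0 Bc; apply: ge_sup; first exact: (specnorm_has_sup B).1.
move=> _ [u /= u1 <-]; rewrite l2norm_le// (le_trans (Bc _))//.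
by rewrite ler_piMr ?sqr_ge0// -(expr1n R 2) -l2norm_le.
Qed.

Lemma specnorm_quad n (B : 'M[R]_n) (u : 'cV[R]_n) :
  `|dotv u (B *m u)| <= specnorm B * dotv u u.
Proof.
rewrite -ler_sqr ?nnegrE ?mulr_ge0 ?specnorm_ge0 ?dotvv_ge0//.
rewrite real_normK ?num_real//.
apply: le_trans (cauchy_schwarz _ _) _.
rewrite exprMn [dotv u u ^+ 2]expr2 mulrA mulrC ler_wpM2r ?dotvv_ge0//.
exact: specnorm_mul.
Qed.

Lemma specnorm_le_frob m n (B : 'M[R]_(m, n)) : specnorm B <= frobnorm B.
Proof. by apply: specnorm_le; [exact: sqrtr_ge0|exact: frobnorm_mul]. Qed.

Lemma l2normD n (u v : 'cV[R]_n) : l2norm (u + v) <= l2norm u + l2norm v.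
Proof.
have uv : dotv u v <= l2norm u * l2norm v.
  rewrite (le_trans (ler_norm _))//.
  rewrite -ler_sqr ?nnegrE ?mulr_ge0 ?l2norm_ge0// real_normK ?num_real//.
  by rewrite exprMn !l2norm_sq cauchy_schwarz.
rewrite l2norm_le ?addr_ge0 ?l2norm_ge0// sqrrD !l2norm_sq.
rewrite dotvDl !dotvDr (dotvC v u); lra.
Qed.

Lemma l2norm_mul m n (B : 'M[R]_(m, n)) (u : 'cV[R]_n) :
  l2norm (B *m u) <= specnorm B * l2norm u.
Proof.
rewrite l2norm_le ?mulr_ge0 ?specnorm_ge0 ?l2norm_ge0//.
by rewrite exprMn l2norm_sq specnorm_mul.
Qed.

Lemma specnormD m n (B C : 'M[R]_(m, n)) :
  specnorm (B + C) <= specnorm B + specnorm C.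
Proof.
apply: specnorm_le => [|u]; first by rewrite addr_ge0 ?specnorm_ge0.
rewrite -[dotv u u]l2norm_sq -exprMn -l2norm_le; last first.
  by rewrite mulr_ge0 ?addr_ge0 ?specnorm_ge0 ?l2norm_ge0.
by rewrite mulmxDl (le_trans (l2normD _ _))// mulrDl lerD ?l2norm_mul.
Qed.

Lemma frobnorm_distC m n (B C : 'M[R]_(m, n)) : frobnorm (B - C) = frobnorm (C - B).
Proof.
congr Num.sqrt; do 2!(apply: eq_bigr => ? _).
by rewrite !mxE -opprB sqrrN.
Qed.

Lemma specnorm_dist m n (B C : 'M[R]_(m, n)) :
  `|specnorm B - specnorm C| <= frobnorm (B - C).
Proof.
have le_dist (X Y : 'M[R]_(m, n)) :
    specnorm X - specnorm Y <= frobnorm (X - Y).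
  rewrite lerBlDr; apply: le_trans (lerD (specnorm_le_frob (X - Y)) (lexx _)).
  by have := specnormD (X - Y) Y; rewrite subrK.
by rewrite ler_norml lerNl opprB {1}frobnorm_distC !le_dist.
Qed.

Lemma posdefmx_psd n (H : 'M[R]_n) : posdefmx H -> psdmx H.
Proof.
case=> Hs Hp; split=> // u; have [->|/Hp/ltW//] := eqVneq u 0.
by rewrite mulmx0 dotv0l.
Qed.

Lemma posdefmx_unit n (H : 'M[R]_n) : posdefmx H -> H \in unitmx.
Proof.
case=> Hs Hp; rewrite unitmxE unitfE; apply/det0P => -[v v0 vH].
have := Hp v^T; rewrite trmx_eq0 => /(_ v0).
by rewrite -[H]Hs -trmx_mul vH trmx0 dotv0r ltxx.
Qed.

(** If [u^T H u = 0] then the square root of [H], hence [H] itself,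
    annihilates [u]. *)
Lemma psdmx_unit_posdef n (H : 'M[R]_n) :
  psdmx H -> H \in unitmx -> posdefmx H.
Proof.
move=> Hp Hu; split=> [|u u0]; first exact: Hp.1.
rewrite lt_neqAle Hp.2 andbT.
have [W [[Ws _] WH]] := psdmx_sqrt_exists Hp.
rewrite -WH -mulmxA dotv_mulmx Ws eq_sym dotvv_eq0.
apply: contra u0 => /eqP Wu0.
by rewrite -(mulKmx Hu u) -WH -mulmxA Wu0 !mulmx0.
Qed.

Lemma sqrtmx_psd n (H : 'M[R]_n) : psdmx H -> psdmx (sqrtmx H).
Proof.
by move=> /psdmx_sqrt_exists[W WH]; rewrite /sqrtmx; case: xgetP => [|/(_ W)//]
  _ -> [].
Qed.

Lemma sqrtmxK n (H : 'M[R]_n) : psdmx H -> sqrtmx H *m sqrtmx H = H.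
Proof.
by move=> /psdmx_sqrt_exists[W WH]; rewrite /sqrtmx; case: xgetP => [|/(_ W)//]
  _ -> [].
Qed.

Lemma sqrtmx_unit n (H : 'M[R]_n) : posdefmx H -> sqrtmx H \in unitmx.
Proof.
move=> Hp; have := posdefmx_unit Hp.
by rewrite -{1}(sqrtmxK (posdefmx_psd Hp)) unitmx_mul => /andP[].
Qed.

Lemma mxnorm_sq n (A : 'M[R]_n) (u : 'cV[R]_n) : psdmx A ->
  mxnorm A u ^+ 2 = dotv u (A *m u).
Proof.
move=> Ap; rewrite l2norm_sq -[in RHS](sqrtmxK Ap) -mulmxA.
by rewrite [RHS]dotv_mulmx (sqrtmx_psd Ap).1.
Qed.

Lemma posdefmx_coercive n (H : 'M[R]_n) : posdefmx H ->
  exists2 lam : R, 0 < lam & forall u, lam * dotv u u <= dotv u (H *m u).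
Proof.
move=> Hp; pose W := sqrtmx H.
have Hpsd := posdefmx_psd Hp.
have s0 := sqr_ge0 (specnorm (invmx W)).
have s1 : 0 < specnorm (invmx W) ^+ 2 + 1 by rewrite ltr_wpDl.
exists (specnorm (invmx W) ^+ 2 + 1)^-1; first by rewrite invr_gt0.
move=> u; rewrite -mxnorm_sq// l2norm_sq mulrC ler_pdivrMr// mulrC.
rewrite -{1 2}(mulKmx (sqrtmx_unit Hp) u) (le_trans (specnorm_mul _ _))//.
by rewrite ler_wpM2r ?dotvv_ge0// lerDl.
Qed.

(** With [D = X - Y] and [K = X^2 - Y^2] one has [K = X D + D Y], so that
    [tr(D K) = tr(D X D) + tr(D Y D) >= lam |D|^2], while
    [tr(D K) <= lam/2 |D|^2 + |K|^2 / (2 lam)].  This is what makes the square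
    root continuous at positive definite matrices. *)
Lemma sqrtmx_lipschitz n (X Y : 'M[R]_n) (lam : R) : 0 < lam ->
  psdmx X -> psdmx Y -> (forall u, lam * dotv u u <= dotv u (X *m u)) ->
  lam ^+ 2 * frobnorm (X - Y) ^+ 2 <= frobnorm (X *m X - Y *m Y) ^+ 2.
Proof.
move=> lam0 [Xs Xp] [Ys Yp] Xlam; set D := X - Y; set K := _ - Y *m Y.
have Ds : D^T = D by rewrite /D linearB /= Xs Ys.
have KE : K = X *m D + D *m Y.
  by rewrite /K /D mulmxBr mulmxBl addrA subrK.
have trq (Z : 'M[R]_n) : \tr (D *m (Z *m D)) =
    \sum_j dotv (col j D) (Z *m col j D).
  apply: eq_bigr => j _.
  by rewrite colE /dotv trmx_mul Ds trmx_delta !mulmxA -colE -!mulmxA -rowE [RHS]mxE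
    [RHS]mxE.
have trDK : lam * frobnorm D ^+ 2 <= \tr (D *m K).
  rewrite KE mulmxDr mxtraceD mulmxA [X in _ + X]mxtrace_mulC -!mulmxA.
  rewrite !trq frobnorm_sq exchange_big/= -[leLHS]addr0 lerD//; last first.
    by apply: sumr_ge0 => j _; exact: Yp.
  rewrite mulr_sumr; apply: ler_sum => j _; apply: le_trans (Xlam _).
  rewrite ler_pM2l// dotvE.
  by apply: ler_sum => i _; rewrite !mxE expr2.
have trDKE : \tr (D *m K) = \sum_i \sum_j D i j * K i j.
  rewrite -{1}Ds exchange_big; apply: eq_bigr => j _; rewrite mxE.
  by apply: eq_bigr => i _; rewrite mxE.
have : \tr (D *m K) <= lam / 2 * frobnorm D ^+ 2 + (2 * lam)^-1 * frobnorm K ^+ 2.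
  rewrite trDKE !frobnorm_sq !mulr_sumr -big_split/=; apply: ler_sum => i _.
  rewrite !mulr_sumr -big_split/=; apply: ler_sum => j _.
  rewrite -subr_ge0 (_ : _ - _ = (2 * lam)^-1 * (lam * D i j - K i j) ^+ 2).
    by rewrite mulr_ge0 ?sqr_ge0// invr_ge0 mulr_ge0// ltW.
  by field; rewrite gt_eqF.
move=> /(le_trans trDK) DK.
have {DK} : lam / 2 * frobnorm D ^+ 2 <= (2 * lam)^-1 * frobnorm K ^+ 2 by lra.
rewrite ler_pdivlMl ?mulr_gt0//; apply: le_trans.
by rewrite le_eqVlt (_ : _ * _ = 2 * lam * (lam / 2 * frobnorm D ^+ 2)) ?eqxx//; field.
Qed.

End LinAlg.

(** * The quadratic objective and the scaled Hessian *)

Section Descent.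
Variable R : realType.

(** Comparing the value at the minimizer with that at small steps against
    the gradient shows that the gradient vanishes there. *)
Lemma quadratic_minE d (phi : 'cV[R]_d -> R) A xs :
  psdmx A -> quadratic_with_hessian phi A -> minimizer phi xs ->
  forall y, phi y = phi xs + 2^-1 * dotv (y - xs) (A *m (y - xs)).
Proof.
move=> Ap phiA phimin y.
suff g0 : grad phi xs = 0 by rewrite (phiA xs y) g0 dotv0l addr0 mxnorm_sq.
set g := grad phi xs.
apply/eqP; rewrite -dotvv_eq0 eq_le dotvv_ge0 andbT.
set q := dotv g (A *m g).
have q0 : 0 <= q by exact: Ap.2.
(* moving by -s g changes phi by -s |g|^2 + s^2 q / 2 *)
have gs s : 0 < s -> dotv g g <= s * q.
  move=> s0; have := phimin (xs - s *: g).
  rewrite (phiA xs (xs - s *: g)) mxnorm_sq// [xs - _ - xs]addrAC subrr add0r -/g.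
  rewrite -scaleNr -scalemxAr !(dotvZl, dotvZr) -/q => h.
  rewrite -(ler_pM2l s0).
  have : 0 <= s ^+ 2 * q by rewrite mulr_ge0 ?sqr_ge0.
  by move: h; lra.
apply/ler_addgt0Pl => e e0; rewrite addr0.
apply: le_trans (gs (e / (q + 1)) _) _.
  by rewrite divr_gt0// ltr_wpDl.
by rewrite mulrAC ler_pdivrMr ?ltr_wpDl// ler_pM2l// lerDl.
Qed.

(** The quadratic-form version of the sketching guarantee: for each [z] it
    is a polynomial condition on the entries of [S], hence measurable, and
    stable under limits. *)
Definition sketch_ok d l (S : 'M[R]_(d, l)) (B : 'M[R]_d) (gamma k : R) :=
  forall z : 'cV[R]_d,
    `|dotv (S^T *m (B *m z)) (S^T *m (B *m z)) - dotv (B *m z) (B *m z)|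
    <= gamma * (specnorm B ^+ 2 + frobnorm B ^+ 2 / k) * dotv z z.

Lemma specnorm_sketch_ok d l (S : 'M[R]_(d, l)) (B : 'M[R]_d) (gamma k : R) :
  specnorm (B^T *m S *m S^T *m B - B^T *m B)
    <= gamma * (specnorm B ^+ 2 + frobnorm B ^+ 2 / k) ->
  sketch_ok S B gamma k.
Proof.
move=> h z; apply: le_trans (ler_wpM2r (dotvv_ge0 z) h).
apply: le_trans (specnorm_quad _ _).
rewrite mulmxBl -!mulmxA dotvDr dotvNr [in leRHS]dotv_mulmx trmxK.
rewrite [dotv (B *m z) (S *m _)]dotv_mulmx.
by rewrite [X in _ <= `|_ - X|]dotv_mulmx trmxK.
Qed.

Section Conditioned.
Variables (d : nat) (A H : 'M[R]_d).
Hypotheses (Ap : psdmx A) (Hp : posdefmx H).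
Let Z := invsqrtmx H.
Let M := scaled_hessian A H.

Lemma invsqrtmx_sym : Z^T = Z.
Proof. by rewrite /Z /invsqrtmx trmx_inv (sqrtmx_psd (posdefmx_psd Hp)).1. Qed.

Lemma invsqrtmx_sq : Z *m Z = invmx H.
Proof.
have Hu := posdefmx_unit Hp; have Wu := sqrtmx_unit Hp.
rewrite -[LHS](mulmxK Hu) -[X in _ *m X *m _](sqrtmxK (posdefmx_psd Hp)).
by rewrite !mulmxA mulmxKV// mulVmx// mul1mx.
Qed.

Lemma scaled_hessian_quad (u : 'cV[R]_d) :
  dotv u (M *m u) = dotv (Z *m u) (A *m (Z *m u)).
Proof. by rewrite /M /scaled_hessian -!mulmxA dotv_mulmx -/Z invsqrtmx_sym. Qed.

Lemma scaled_hessian_psd : psdmx M.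
Proof.
split=> [|u]; last by rewrite scaled_hessian_quad; exact: Ap.2.
by rewrite /M /scaled_hessian !trmx_mul invsqrtmx_sym Ap.1 mulmxA.
Qed.

Lemma scaled_hessian_tr : \tr M = \tr (invmx H *m A).
Proof.
by rewrite /M /scaled_hessian mxtrace_mulC mulmxA -/Z invsqrtmx_sq.
Qed.

Lemma psdmx_tr_ge0 n (B : 'M[R]_n) : psdmx B -> 0 <= \tr B.
Proof.
move=> [_ Bp]; apply: sumr_ge0 => i _.
have := Bp (delta_mx i 0).
by rewrite /dotv trmx_delta -colE -rowE !mxE.
Qed.

Lemma trace_ge0 : 0 <= \tr (invmx H *m A).
Proof. by rewrite -scaled_hessian_tr psdmx_tr_ge0//; exact: scaled_hessian_psd. Qed.

Variable rho : R.
Hypotheses (rho0 : 0 < rho) (HA : loewner (rho *: H) A).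

Lemma loewner_quad (u : 'cV[R]_d) : rho * dotv u (H *m u) <= dotv u (A *m u).
Proof.
have := HA.2 u; rewrite mulmxBl dotvDr dotvNr subr_ge0.
by rewrite -scalemxAl dotvZr.
Qed.

Lemma sqrtmx_quad n (B : 'M[R]_n) (u : 'cV[R]_n) : psdmx B ->
  dotv (sqrtmx B *m u) (sqrtmx B *m u) = dotv u (B *m u).
Proof. by move=> Bp; rewrite -mxnorm_sq// l2norm_sq. Qed.

Lemma scaled_hessian_ge (u : 'cV[R]_d) : rho * dotv u u <= dotv u (M *m u).
Proof.
rewrite scaled_hessian_quad; apply: le_trans (loewner_quad _).
rewrite ler_pM2l// -sqrtmx_quad ?mulKVmx ?sqrtmx_unit//.
exact: posdefmx_psd.
Qed.

Lemma scaled_hessian_posdef : posdefmx M.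
Proof.
split=> [|u u0]; first exact: scaled_hessian_psd.1.
apply: lt_le_trans (scaled_hessian_ge u).
by rewrite mulr_gt0// lt_neqAle eq_sym dotvv_eq0 u0 dotvv_ge0.
Qed.

Lemma specnorm_ge_rho : (0 < d)%N -> rho <= specnorm M.
Proof.
move=> d0; pose u : 'cV[R]_d := delta_mx (Ordinal d0) 0.
have uu : dotv u u = 1.
  rewrite /dotv trmx_delta -rowE !mxE eqxx.
  by rewrite eqxx.
have := le_trans (scaled_hessian_ge u) (le_trans (ler_norm _) (specnorm_quad _ _)).
by rewrite uu !mulr1.
Qed.

(** The Polyak-Lojasiewicz inequality in the metric of [H]: with
    [y = H^{1/2} p] and [g = H^{-1/2} A p], Cauchy-Schwarz gives
    [(p^T A p)^2 = (y . g)^2 <= |y|^2 |g|^2], and [rho |y|^2 <= p^T A p]. *)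
Lemma gap_le (p : 'cV[R]_d) :
  rho * dotv p (A *m p) <= dotv (Z *m (A *m p)) (Z *m (A *m p)).
Proof.
set q := dotv p _; set g := Z *m _.
have q0 : 0 <= q by exact: Ap.2.
have [q00|qN0] := eqVneq q 0; first by rewrite q00 mulr0 dotvv_ge0.
have qp : 0 < q by rewrite lt_neqAle eq_sym qN0.
pose y := sqrtmx H *m p.
have qE : q = dotv y g.
  rewrite /y /g dotvC dotv_mulmx (sqrtmx_psd (posdefmx_psd Hp)).1.
  by rewrite mulKVmx ?sqrtmx_unit// dotvC.
have yy : rho * dotv y y <= q.
  by rewrite sqrtmx_quad; [exact: loewner_quad|exact: posdefmx_psd].
have := cauchy_schwarz y g; rewrite -qE => cs.
rewrite -(ler_pM2l qp).
have := ler_wpM2l (ltW rho0) cs.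
have := ler_wpM2r (dotvv_ge0 g) yy.
by set gg := dotv g g; set Y := dotv y y => h1 h2; lra.
Qed.

End Conditioned.

End Descent.

(** * The test matrix *)

Section Test.
Variables (R : realType) (d : nat).
Implicit Types (A H M : 'M[R]_d) (g p : 'cV[R]_d).

(** Normalized so that the rank one term of [boosted] has trace
    [(specnorm M + tr M / k) / 2], or is zero when [g = 0]. *)
Definition rank1_weight M g (k : R) : R :=
  (specnorm M + \tr M / k) / (2 * dotv g g).

(** The square of the test matrix: [M] controls the curvature along the
    sketch, the multiple of [g g^T] makes the sketch see the gradient. *)
Definition boosted M g (k : R) : 'M[R]_d :=
  M + rank1_weight M g k *: (g *m g^T).

Definition test_mx A H (k : R) p : 'M[R]_d :=
  sqrtmx (boosted (scaled_hessian A H) (invsqrtmx H *m (A *m p)) k).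

Section Boost.
Variables (M : 'M[R]_d) (g : 'cV[R]_d) (k : R).
Hypotheses (Mp : psdmx M) (k1 : 1 <= k).
Let c1 := rank1_weight M g k.
Let Q := boosted M g k.
Let B := sqrtmx Q.
Let m := specnorm M + \tr M / k.

Let k0 : 0 < k. Proof. exact: lt_le_trans k1. Qed.

Let m0 : 0 <= m.
Proof. by rewrite addr_ge0 ?specnorm_ge0// divr_ge0 ?psdmx_tr_ge0// ltW. Qed.

Lemma rank1_weight_ge0 : 0 <= c1.
Proof. by rewrite divr_ge0 ?mulr_ge0 ?dotvv_ge0. Qed.

Lemma rank1_weight_le : c1 * dotv g g <= m / 2.
Proof.
rewrite /c1 /rank1_weight -/m; have [->|g0] := eqVneq (dotv g g) 0.
  by rewrite mulr0 divr_ge0.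
by rewrite invfM mulrA divfK.
Qed.

Lemma boosted_quad u : dotv u (Q *m u) = dotv u (M *m u) + c1 * dotv g u ^+ 2.
Proof.
rewrite mulmxDl dotvDr -scalemxAl dotvZr; congr (_ + _ * _).
by rewrite -mulmxA dotv_mulmx dotvE big_ord1 -expr2.
Qed.

Lemma boosted_psd : psdmx Q.
Proof.
split=> [|u]; last first.
  by rewrite boosted_quad addr_ge0 ?Mp.2// mulr_ge0 ?sqr_ge0 ?rank1_weight_ge0.
by rewrite /Q /boosted linearD linearZ /= trmx_mul trmxK Mp.1.
Qed.

Lemma boosted_tr : \tr Q = \tr M + c1 * dotv g g.
Proof.
rewrite mxtraceD mxtraceZ mxtrace_mulC /dotv /mxtrace; congr (_ + _ * _).
by rewrite big_ord1.
Qed.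

Lemma test_sym : B^T = B. Proof. exact: (sqrtmx_psd boosted_psd).1. Qed.

Lemma test_quad u :
  dotv (B *m u) (B *m u) = dotv u (M *m u) + c1 * dotv g u ^+ 2.
Proof. by rewrite sqrtmx_quad ?boosted_quad//; exact: boosted_psd. Qed.

Lemma test_specnorm : specnorm B ^+ 2 <= specnorm M + c1 * dotv g g.
Proof.
have s0 : 0 <= specnorm M + c1 * dotv g g.
  by rewrite addr_ge0 ?specnorm_ge0// mulr_ge0 ?dotvv_ge0 ?rank1_weight_ge0.
rewrite -[leRHS]sqr_sqrtr// ler_sqr ?nnegrE ?specnorm_ge0 ?sqrtr_ge0//.
apply: specnorm_le => [|u]; first exact: sqrtr_ge0.
rewrite sqr_sqrtr// test_quad mulrDl lerD//.
  by apply: le_trans (specnorm_quad _ _); exact: ler_norm.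
by rewrite -mulrA ler_wpM2l ?rank1_weight_ge0// cauchy_schwarz.
Qed.

Lemma test_frobnorm : frobnorm B ^+ 2 = \tr M + c1 * dotv g g.
Proof.
by rewrite frobnorm_tr test_sym sqrtmxK ?boosted_tr//; exact: boosted_psd.
Qed.

Lemma boosted_posdef : posdefmx M -> posdefmx Q.
Proof.
move=> Mu; split=> [|u u0]; first exact: boosted_psd.1.
rewrite boosted_quad ltr_wpDr ?Mu.2//.
by rewrite mulr_ge0 ?sqr_ge0 ?rank1_weight_ge0.
Qed.

Variables (l : nat) (S : 'M[R]_(d, l)).
Hypothesis SB : sketch_ok S B 4^-1 k.
Hypothesis k3 : 3 <= k.

(* For k >= 3 the factor 1 + 1/k of the rank one term is at most 4/3. *)
Let eps := 4^-1 * (specnorm B ^+ 2 + frobnorm B ^+ 2 / k).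

Let eps_le : eps <= 4^-1 * (m + 4 / 3 * (c1 * dotv g g)).
Proof.
rewrite /eps ler_pM2l ?invr_gt0// test_frobnorm mulrDl.
have := test_specnorm; rewrite /m.
have c0 : 0 <= c1 * dotv g g by rewrite mulr_ge0 ?dotvv_ge0 ?rank1_weight_ge0.
have : c1 * dotv g g / k <= c1 * dotv g g / 3.
  by rewrite ler_wpM2l// lef_pV2// posrE ltr0n.
set a := specnorm M; set b := specnorm B ^+ 2; set c := c1 * _; set t := \tr M / k.
by move=> h1 h2; lra.
Qed.

(** Since [B^2] dominates [M] it is enough to bound [|B S c|^2].  By duality
    this is at most [|c|^2] times the largest value of [|S^T B z|^2] on unit
    vectors, which exceeds [specnorm B ^+ 2] by at most [eps]; the rank one
    weight is small enough for the total to be below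
    [2 specnorm M + tr M / k]. *)
Lemma sketch_quad_le (c : 'cV[R]_l) :
  dotv (S *m c) (M *m (S *m c)) <= (2 * specnorm M + \tr M / k) * dotv c c.
Proof.
pose W := B *m (S *m c).
have WWE : dotv W W = dotv c (S^T *m (B *m W)).
  by rewrite {1}/W dotvC dotv_mulmx test_sym dotv_mulmx dotvC.
have MW : dotv (S *m c) (M *m (S *m c)) <= dotv W W.
  by rewrite test_quad lerDl mulr_ge0 ?sqr_ge0 ?rank1_weight_ge0.
apply: le_trans MW _.
have [W0|W0] := eqVneq (dotv W W) 0.
  rewrite W0 mulr_ge0 ?dotvv_ge0//.
  by have := m0; have := specnorm_ge0 M; rewrite /m; lra.
have Wp : 0 < dotv W W by rewrite lt_neqAle eq_sym W0 dotvv_ge0.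
rewrite -(ler_pM2r Wp) -[X in X <= _]expr2 {1}WWE.
apply: le_trans (cauchy_schwarz _ _) _.
rewrite [_ * dotv c c]mulrC -mulrA ler_wpM2l ?dotvv_ge0//.
have := SB W; rewrite -/eps ler_norml => /andP[_].
have BW : dotv (B *m W) (B *m W) <= (specnorm M + c1 * dotv g g) * dotv W W.
  apply: le_trans (specnorm_mul _ _) _.
  by rewrite ler_wpM2r ?dotvv_ge0// test_specnorm.
rewrite lerBlDr => /le_trans; apply.
apply: le_trans (lerD (lexx _) BW) _.
rewrite -mulrDl ler_wpM2r ?dotvv_ge0//.
have := eps_le; have := rank1_weight_le; have := m0; rewrite /m.
set t := \tr M / k; set c' := c1 * _; lra.
Qed.

Hypothesis Mu : posdefmx M.

(** Take [z = B^{-1} g].  As [B^2] dominates [c1 g g^T], one has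
    [c1 |z|^2 <= 1], so the sketching error at [z] is at most
    [eps / c1 <= 5/6 |g|^2]. *)
Lemma sketch_grad_ge : dotv g g / 6 <= dotv (S^T *m g) (S^T *m g).
Proof.
have Bu : B \in unitmx by exact/sqrtmx_unit/boosted_posdef.
have [g00|g0] := eqVneq (dotv g g) 0; first by rewrite g00 mul0r dotvv_ge0.
pose z := invmx B *m g; pose y := invmx B *m z.
have Bz : B *m z = g by rewrite mulKVmx.
have By : B *m y = z by rewrite mulKVmx.
have gy : dotv g y = dotv z z.
  by rewrite -Bz dotvC dotv_mulmx test_sym By.
have zz : c1 * dotv z z ^+ 2 <= dotv z z.
  have := test_quad y; rewrite By gy => zzE.
  by rewrite [leRHS]zzE lerDr Mp.2.
have {}zz : c1 * dotv z z <= 1.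
  have [->|z0] := eqVneq (dotv z z) 0; first by rewrite mulr0.
  have zp : 0 < dotv z z by rewrite lt_neqAle eq_sym z0 dotvv_ge0.
  by move: zz; rewrite expr2 mulrA -[leRHS]mul1r ler_pM2r.
have cE : c1 * dotv g g = m / 2.
  by rewrite /c1 /rank1_weight -/m invfM mulrA divfK.
have := SB z; rewrite Bz -/eps ler_norml => /andP[+ _].
have : eps * dotv z z <= 5 / 6 * dotv g g.
  apply: le_trans (_ : 5 / 6 * (c1 * dotv g g) * dotv z z <= _).
    by rewrite ler_wpM2r ?dotvv_ge0//; have := eps_le; rewrite cE; lra.
  rewrite -mulrA ler_pM2l ?divr_gt0// mulrAC -[leRHS]mul1r.
  by rewrite ler_wpM2r ?dotvv_ge0.
set G := dotv (_ *m _) _; lra.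
Qed.

End Boost.

End Test.

(** * Descent in one step *)

Section Step.
Variables (R : realType) (d l : nat).
Variables (phi f : 'cV[R]_d -> R) (A H : 'M[R]_d) (xs : 'cV[R]_d).
Variables (rho sigma alpha k : R) (S : 'M[R]_(d, l)).
Hypotheses (Ap : psdmx A) (Hp : posdefmx H).
Hypotheses (rho0 : 0 < rho) (HA : loewner (rho *: H) A).
Hypothesis phiE : forall y,
  phi y = phi xs + 2^-1 * dotv (y - xs) (A *m (y - xs)).
Hypotheses (sigma0 : 0 <= sigma) (fphi : forall y, `|f y - phi y| <= sigma).
Hypotheses (alpha0 : 0 < alpha) (k3 : 3 <= k).

Let Z := invsqrtmx H.
Let M := scaled_hessian A H.

(** Central differences are exact on quadratic functions: the second order
    terms cancel. *)
Lemma central_diff_quad x v :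
  central_diff phi alpha x v = dotv (A *m (x - xs)) v.
Proof.
rewrite /central_diff !(phiE (x + _)) ![x + _ - xs]addrAC.
move: (x - xs) => p.
rewrite -scaleNr !mulmxDr -!scalemxAr !(dotvDl, dotvDr, dotvZl, dotvZr).
have -> : dotv v (A *m p) = dotv (A *m p) v by rewrite dotvC.
have -> : dotv p (A *m v) = dotv (A *m p) v by rewrite dotv_mulmx Ap.1.
by field; rewrite gt_eqF.
Qed.

Lemma central_diff_err x v :
  `|central_diff f alpha x v - dotv (A *m (x - xs)) v| <= sigma / alpha.
Proof.
rewrite -central_diff_quad /central_diff -mulrBl normrM.
rewrite [`|_^-1|]ger0_norm ?invr_ge0 ?mulr_ge0 ?(ltW alpha0)//.
rewrite ler_pdivrMr ?mulr_gt0// mulrCA divfK ?gt_eqF//.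
have := fphi (x + alpha *: v); have := fphi (x - alpha *: v).
rewrite !ler_norml => /andP[h1 h2] /andP[h3 h4]; apply/andP; split; lra.
Qed.

Let eta := step_size A H k.

Lemma step_size_ge0 : 0 <= eta.
Proof.
rewrite invr_ge0 addr_ge0 ?mulr_ge0 ?specnorm_ge0// ?invr_ge0; last first.
  by rewrite (le_trans _ k3).
exact: trace_ge0.
Qed.

(** Let [c = u + e], with [u = S^T g] the exact central differences and [e]
    the noise.  The new gap is [gap - eta u.c + eta^2/2 (S c)^T M (S c)], and
    [eta (S c)^T M (S c) <= |c|^2], so the change is at most
    [- eta u.c + eta/2 |c|^2 = - eta/2 |u|^2 + eta/2 |e|^2].  Finally
    [|u|^2 >= |g|^2 / 6 >= rho gap / 3]. *)
Lemma zo_step_gap x :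
  sketch_ok S (test_mx A H k (x - xs)) 4^-1 k ->
  phi (zo_step f A alpha k H S x) - phi xs <=
    (1 - eta * rho / 6) * (phi x - phi xs)
    + eta / 2 * (l%:R * (sigma / alpha) ^+ 2).
Proof.
have [p pE] : {p | p = x - xs} by exists (x - xs).
rewrite -pE => SB; pose g := Z *m (A *m p).
have k1 : 1 <= k by apply: le_trans k3; rewrite ler1n.
have Mp : psdmx M by exact: scaled_hessian_psd.
have Mu : posdefmx M by exact: (scaled_hessian_posdef Ap Hp rho0 HA).
pose c : 'cV[R]_l := \col_i central_diff f alpha x (Z *m col i S).
pose u := S^T *m g; pose e := c - u.
have ee : dotv e e <= l%:R * (sigma / alpha) ^+ 2.
  rewrite dotvE -[X in l%:R * X]mulr1 mulr_natl -[l in leRHS]card_ord -sumr_const.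
  apply: ler_sum => i _; rewrite -expr2 -real_normK ?num_real//.
  rewrite mulr1 ler_sqr ?nnegrE ?divr_ge0 ?(ltW alpha0)//.
  have := central_diff_err x (Z *m col i S); rewrite -pE.
  suff -> : dotv (A *m p) (Z *m col i S) = u i 0 by rewrite !mxE.
  rewrite dotv_mulmx invsqrtmx_sym// -/g dotvC /dotv tr_col.
  by rewrite -row_mul mxE.
pose y := S *m c.
have stepE : zo_step f A alpha k H S x - xs = p - eta *: (Z *m y).
  rewrite /zo_step -/eta addrAC -pE; congr (_ - _ *: _).
  rewrite /y; apply/matrixP => i j; rewrite ord1 summxE mulmxA mxE.
  apply: eq_bigr => q _; rewrite !mxE mulrC; congr (_ * _).
  by apply: eq_bigr => r _; rewrite ?mxE.
have gapE q : phi q - phi xs = 2^-1 * dotv (q - xs) (A *m (q - xs)).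
  by rewrite phiE addrAC subrr add0r.
have -> : phi (zo_step f A alpha k H S x) - phi xs =
    phi x - phi xs - eta * dotv u c + 2^-1 * eta ^+ 2 * dotv y (M *m y).
  rewrite !gapE stepE -pE scaled_hessian_quad// -/Z.
  rewrite -scaleNr !mulmxDr -!scalemxAr !(dotvDl, dotvDr, dotvZl, dotvZr).
  have -> : dotv p (A *m (Z *m y)) = dotv u c.
    by rewrite dotv_mulmx Ap.1 dotv_mulmx invsqrtmx_sym// -/g dotv_mulmx.
  have -> : dotv (Z *m y) (A *m p) = dotv u c.
    by rewrite dotvC dotv_mulmx invsqrtmx_sym// -/g dotv_mulmx.
  by field.
(* the inequality that dictates the step size *)
have e1 : eta * (2 * specnorm M + \tr M / k) <= 1.
  have a0 := specnorm_ge0 M.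
  have t0 : 0 <= \tr M / k by rewrite divr_ge0 ?psdmx_tr_ge0// (le_trans _ k1).
  rewrite /eta /step_size -scaled_hessian_tr// -/M.
  set q := 5 * _ + _.
  have [->|q0] := eqVneq q 0; first by rewrite invr0 mul0r.
  have qp : 0 < q by rewrite lt_neqAle eq_sym q0 /q; lra.
  by rewrite mulrC ler_pdivrMr// /q; lra.
have eta0 := step_size_ge0.
have yMy := sketch_quad_le Mp k1 SB k3 c.
have uu : dotv g g / 6 <= dotv u u := sketch_grad_ge Mp k1 SB k3 Mu.
have gap : rho * dotv p (A *m p) <= dotv g g := gap_le Ap Hp rho0 HA p.
have quad : 2^-1 * eta ^+ 2 * dotv y (M *m y) <= eta / 2 * dotv c c.
  apply: le_trans (_ : 2^-1 * eta ^+ 2 * ((2 * specnorm M + \tr M / k) * dotv c c) <= _).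
    by rewrite ler_wpM2l// mulr_ge0 ?sqr_ge0 ?invr_ge0.
  rewrite (_ : _ * (_ * _) = eta / 2 * dotv c c * (eta * (2 * specnorm M + \tr M / k))).
    by rewrite ler_piMr// mulr_ge0 ?dotvv_ge0// divr_ge0.
  by ring.
have cE : c = u + e by rewrite addrC subrK.
clearbody e.
have cc : dotv c c = dotv u u + 2 * dotv u e + dotv e e.
  by rewrite cE !(dotvDl, dotvDr) (dotvC e u); ring.
have uc : dotv u c = dotv u u + dotv u e.
  by rewrite cE dotvDr.
rewrite gapE -pE.
have h1 := ler_wpM2l eta0 uu; have h2 := ler_wpM2l eta0 gap.
have h3 := ler_wpM2l eta0 ee.
move: quad h1 h2 h3; rewrite cc uc.
set q := dotv p _; set gg := dotv g g; set uu' := dotv u u.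
set ue := dotv u e; set ee' := dotv e e; set Y := dotv y _.
set E := l%:R * _ ^+ 2.
lra.
Qed.

End Step.

(** * Iterating the descent inequality *)

Section Iterate.
Variable R : realType.

(** [3 E / rhom] is above the fixed point [3 E / rho t] of each affine
    step, so the excess over it contracts. *)
Lemma noisy_contraction (T : nat) (D eta rho : nat -> R) (E rhom beta : R) :
  0 <= D 0%N -> 0 <= E -> 0 < rhom -> 0 <= beta ->
  (forall t, (t < T)%N -> D t.+1 <=
     (1 - eta t * rho t / 6) * D t + eta t / 2 * E) ->
  (forall t, (t < T)%N -> 0 <= eta t) ->
  (forall t, (t < T)%N -> rhom <= rho t) ->
  (forall t, (t < T)%N -> beta <= eta t * rho t / 6 <= 1) ->
  forall t, (t <= T)%N -> D t <= 3 * E / rhom + (1 - beta) ^+ t * D 0%N.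
Proof.
move=> D0 E0 rhom0 beta0 DS eta0 rhoP r1.
have q0 : 0 <= 3 * E / rhom by rewrite divr_ge0 ?mulr_ge0// ltW.
elim=> [_|t IH tT]; first by rewrite expr0 mul1r lerDr.
apply: le_trans (DS _ tT) _.
have := r1 _ tT; set r := eta t * rho t / 6 => /andP[br r1'].
apply: le_trans (lerD (ler_wpM2l _ (IH (ltnW tT))) (lexx _)) _; first by lra.
rewrite mulrDr exprS addrAC lerD//; last first.
  rewrite mulrA ler_wpM2r// ler_wpM2r//; last by lra.
  by rewrite exprn_ge0//; lra.
have noise : eta t / 2 * E <= r * (3 * E / rhom).
  rewrite mulrA ler_pdivlMr// /r.
  have := ler_wpM2l (mulr_ge0 (eta0 _ tT) E0) (rhoP _ tT); lra.
lra.
Qed.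

Lemma le_max_upto T (F : nat -> R) t : (t < T)%N -> F t <= max_upto T F.
Proof. by move=> tT; exact: (le_bigmax _ (fun t : 'I_T => F t) (Ordinal tT)). Qed.

Lemma ge_min_upto T (F : nat -> R) t : (t < T)%N -> min_upto T F <= F t.
Proof. by move=> tT; exact: (bigmin_le _ (Ordinal tT)). Qed.

Lemma min_upto_gt0 T (F : nat -> R) : (0 < T)%N ->
  (forall t, (t < T)%N -> 0 < F t) -> 0 < min_upto T F.
Proof. by move=> T0 F0; apply: lt_bigmin => [|i _]; exact: F0. Qed.

Lemma max_upto_le T (F : nat -> R) c : (0 < T)%N ->
  (forall t, (t < T)%N -> F t <= c) -> max_upto T F <= c.
Proof. by move=> T0 Fc; apply: bigmax_le => [|i _]; exact: Fc. Qed.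

Lemma pow1B_le_expR (beta : R) (n : nat) : beta <= 1 ->
  (1 - beta) ^+ n <= expR (- (n%:R * beta)).
Proof.
move=> b1; rewrite -mulrN expRM_natl lerXn2r ?nnegrE ?expR_ge0 ?subr_ge0//.
exact: expR_ge1Dx.
Qed.

Section Run.
Variables (d l T : nat) (phi f : 'cV[R]_d -> R) (A : 'M[R]_d).
Variables (x0 xs : 'cV[R]_d) (sigma alpha k : R).
Variables (H : nat -> 'M[R]_d) (S : nat -> 'M[R]_(d, l)) (rho : nat -> R).
Hypotheses (T0 : (0 < T)%N) (d0 : (0 < d)%N) (Ap : psdmx A).
Hypothesis phiE : forall y,
  phi y = phi xs + 2^-1 * dotv (y - xs) (A *m (y - xs)).
Hypotheses (sigma0 : 0 <= sigma) (fphi : forall y, `|f y - phi y| <= sigma).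
Hypotheses (alpha0 : 0 < alpha) (k0 : 0 < k).
Hypothesis HP : forall t, (t < T)%N ->
  [/\ posdefmx (H t), 0 < rho t & loewner (rho t *: H t) A].
Let x := zo_iter f A alpha k H S x0.
Hypothesis SP : forall t, (t < T)%N ->
  sketch_ok (S t) (test_mx A (H t) k (x t - xs)) 4^-1 k.

Let kappa := max_upto T (fun t => (rho t)^-1 *
  (specnorm (scaled_hessian A (H t)) + \tr (invmx (H t) *m A) / k)).

Lemma kappa_ge1 : 1 <= kappa.
Proof.
apply: le_trans (le_max_upto _ T0); have [Hp r0 HA] := HP T0.
rewrite ler_pdivlMl// mulr1 -[leLHS]addr0 lerD//.
  exact: specnorm_ge_rho.
by rewrite divr_ge0 ?trace_ge0// ltW.
Qed.

Hypothesis k3 : 3 <= k.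

(** Each contraction rate [eta_t rho_t / 6] lies between [1 / (30 kappa)]
    and [1], because [rho_t <= specnorm (scaled_hessian A (H t))]. *)
Lemma zo_iter_gap :
  phi (x T) - phi xs <=
    3 * (l%:R * (sigma / alpha) ^+ 2) / min_upto T rho
    + expR (- (T%:R * (30 * kappa)^-1)) * (phi x0 - phi xs).
Proof.
have kp := kappa_ge1.
have kp0 : 0 < kappa by exact: lt_le_trans kp.
have b0 : 0 < (30 * kappa)^-1 by rewrite invr_gt0 mulr_gt0.
have b1 : (30 * kappa)^-1 <= 1.
  by rewrite invf_le1 ?mulr_gt0// (le_trans kp)// ler_pMl// ler1n.
have gap0 : 0 <= phi x0 - phi xs.
  by rewrite (phiE x0) addrAC subrr add0r mulr_ge0//; exact: Ap.2.
apply: le_trans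
  (lerD (lexx _) (ler_wpM2r gap0 (pow1B_le_expR T b1))).
apply: (@noisy_contraction T (fun t => phi (x t) - phi xs)
  (fun t => step_size A (H t) k) rho) => //.
- by rewrite mulr_ge0 ?sqr_ge0.
- by apply: min_upto_gt0 => // t /HP[].
- exact: ltW.
- move=> t tT; have [Hp r0 HA] := HP tT.
  by apply: (zo_step_gap Ap Hp r0 HA) => //; exact: SP.
- by move=> t tT; have [Hp r0 HA] := HP tT; exact: step_size_ge0.
- by move=> t tT; exact: ge_min_upto.
move=> t tT; have [Hp r0 HA] := HP tT.
have ra := specnorm_ge_rho Hp r0 HA d0.
have t0 : 0 <= \tr (invmx (H t) *m A) / k by rewrite divr_ge0 ?trace_ge0// ltW.
have := le_max_upto (fun t => (rho t)^-1 *
  (specnorm (scaled_hessian A (H t)) + \tr (invmx (H t) *m A) / k)) tT.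
rewrite -/kappa /step_size ler_pdivrMl//.
move: ra t0; set a := specnorm _; set tau := _ / k => ra t0 kt.
have q0 : 0 < 5 * a + tau by lra.
have -> : (5 * a + tau)^-1 * rho t / 6 = rho t / 6 / (5 * a + tau).
  by rewrite -mulrA mulrC.
apply/andP; split.
  rewrite ler_pdivlMr// ler_pdivrMl ?mulr_gt0//; lra.
rewrite ler_pdivrMr//; lra.
Qed.

End Run.
End Iterate.

(** * Entrywise convergence of matrices *)

Section Convergence.
Variable R : realType.
Implicit Types m n : nat.

(** Entrywise convergence, which turns the continuity of matrix operations
    into that of sums and products of real sequences. *)
Definition mxcvg m n (u : nat -> 'M[R]_(m, n)) (B : 'M[R]_(m, n)) :=
  forall i j, (fun N => u N i j) @ \oo --> B i j.

Lemma cvg_sumr (I : Type) (r : seq I) (P : pred I) (F : I -> nat -> R)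
    (L : I -> R) : (forall i, F i @ \oo --> L i) ->
  (fun N => \sum_(i <- r | P i) F i N) @ \oo --> \sum_(i <- r | P i) L i.
Proof. by move=> FL; apply: cvg_big => [|i _]; [exact: add_continuous|exact: FL]. Qed.

Lemma cvg_prodr (I : Type) (r : seq I) (P : pred I) (F : I -> nat -> R)
    (L : I -> R) : (forall i, F i @ \oo --> L i) ->
  (fun N => \prod_(i <- r | P i) F i N) @ \oo --> \prod_(i <- r | P i) L i.
Proof. by move=> FL; apply: cvg_big => [|i _]; [exact: mul_continuous|exact: FL]. Qed.

Lemma mxcvg_cst m n (B : 'M[R]_(m, n)) : mxcvg (fun=> B) B.
Proof. by move=> i j; exact: cvg_cst. Qed.

Lemma mxcvgD m n (u v : nat -> 'M[R]_(m, n)) B C :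
  mxcvg u B -> mxcvg v C -> mxcvg (fun N => u N + v N) (B + C).
Proof.
move=> uB vC i j; rewrite mxE; under eq_fun do rewrite mxE.
exact: cvgD.
Qed.

Lemma mxcvgB m n (u v : nat -> 'M[R]_(m, n)) B C :
  mxcvg u B -> mxcvg v C -> mxcvg (fun N => u N - v N) (B - C).
Proof.
move=> uB vC i j; rewrite !mxE; under eq_fun do rewrite !mxE.
exact: cvgB.
Qed.

Lemma mxcvgZ m n (a : nat -> R) (u : nat -> 'M[R]_(m, n)) (c : R) B :
  a @ \oo --> c -> mxcvg u B -> mxcvg (fun N => a N *: u N) (c *: B).
Proof.
move=> ac uB i j; rewrite mxE; under eq_fun do rewrite mxE.
exact: cvgM.
Qed.

Lemma mxcvg_tr m n (u : nat -> 'M[R]_(m, n)) B :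
  mxcvg u B -> mxcvg (fun N => (u N)^T) B^T.
Proof. by move=> uB i j; rewrite mxE; under eq_fun do rewrite mxE; exact: uB. Qed.

Lemma mxcvgM m n q (u : nat -> 'M[R]_(m, n)) (v : nat -> 'M[R]_(n, q)) B C :
  mxcvg u B -> mxcvg v C -> mxcvg (fun N => u N *m v N) (B *m C).
Proof.
move=> uB vC i j; rewrite mxE; under eq_fun do rewrite mxE.
by apply: cvg_sumr => r; exact: cvgM.
Qed.

Lemma cvg_mxtrace n (u : nat -> 'M[R]_n) B :
  mxcvg u B -> (fun N => \tr (u N)) @ \oo --> \tr B.
Proof. by move=> uB; exact: cvg_sumr. Qed.

Lemma cvg_dotv n (u v : nat -> 'cV[R]_n) B C :
  mxcvg u B -> mxcvg v C -> (fun N => dotv (u N) (v N)) @ \oo --> dotv B C.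
Proof. by move=> uB vC; exact: (mxcvgM (mxcvg_tr uB) vC). Qed.

Lemma cvg_det n (u : nat -> 'M[R]_n) B :
  mxcvg u B -> (fun N => \det (u N)) @ \oo --> \det B.
Proof.
move=> uB; apply: cvg_sumr => s.
by apply: cvgM; [exact: cvg_cst|apply: cvg_prodr => i; exact: uB].
Qed.

Lemma mxcvg_adj n (u : nat -> 'M[R]_n) B :
  mxcvg u B -> mxcvg (fun N => \adj (u N)) (\adj B).
Proof.
move=> uB i j; rewrite mxE; under eq_fun do rewrite mxE.
rewrite /cofactor; apply: cvgM; first exact: cvg_cst.
apply: cvg_det => r s; rewrite !mxE; under eq_fun do rewrite !mxE.
exact: uB.
Qed.

Lemma mxcvg_inv n (u : nat -> 'M[R]_n) B :
  (forall N, u N \in unitmx) -> B \in unitmx ->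
  mxcvg u B -> mxcvg (fun N => invmx (u N)) (invmx B).
Proof.
move=> uu Bu uB; rewrite /invmx Bu; under eq_fun do rewrite uu.
apply: mxcvgZ; last exact: mxcvg_adj.
by apply: cvgV (cvg_det uB); move: Bu; rewrite unitmxE unitfE.
Qed.

Lemma cvg_frobnorm_sq m n (u : nat -> 'M[R]_(m, n)) B :
  mxcvg u B -> (fun N => frobnorm (u N) ^+ 2) @ \oo --> frobnorm B ^+ 2.
Proof.
move=> uB; rewrite frobnorm_sq; under eq_fun do rewrite frobnorm_sq.
do 2!(apply: cvg_sumr => ?); rewrite expr2; under eq_fun do rewrite expr2.
by apply: cvgM; exact: uB.
Qed.

Lemma cvg_frobnormB m n (u : nat -> 'M[R]_(m, n)) B :
  mxcvg u B -> (fun N => frobnorm (u N - B) ^+ 2) @ \oo --> (0 : R).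
Proof.
move=> uB; have := cvg_frobnorm_sq (mxcvgB uB (@mxcvg_cst _ _ B)).
suff -> : frobnorm (B - B) ^+ 2 = 0 by [].
rewrite frobnorm_sq big1// => i _; rewrite big1// => j _.
by rewrite subrr mxE expr0n.
Qed.

Lemma mxcvg_frob m n (u : nat -> 'M[R]_(m, n)) B (e : nat -> R) :
  e @ \oo --> (0 : R) -> (forall N, frobnorm (u N - B) ^+ 2 <= e N) -> mxcvg u B.
Proof.
move=> e0 ue i j; apply/cvgrPdist_lt => eps eps0.
have eps2 : 0 < eps ^+ 2 by rewrite exprn_gt0.
near=> N; rewrite -ltr_sqr ?nnegrE ?(ltW eps0)//.
rewrite real_normK ?num_real//.
apply: le_lt_trans (_ : frobnorm (u N - B) ^+ 2 < _).
  rewrite frobnorm_sq (bigD1 i)//= (bigD1 j)//= !mxE -addrA -sqrrN opprB lerDl.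
  by rewrite addr_ge0//; do ?[apply: sumr_ge0 => ? _]; rewrite ?sqr_ge0.
apply: le_lt_trans (ue N) _.
by near: N; exact: (cvgr_lt (0 : R)).
Unshelve. all: by end_near. Qed.

Lemma cvg_specnorm m n (u : nat -> 'M[R]_(m, n)) B :
  mxcvg u B -> (fun N => specnorm (u N)) @ \oo --> specnorm B.
Proof.
move=> uB; apply/cvgrPdist_lt => eps eps0.
have eps2 : 0 < eps ^+ 2 by rewrite exprn_gt0.
near=> N; rewrite distrC; apply: le_lt_trans (specnorm_dist _ _) _.
rewrite -ltr_sqr ?nnegrE ?sqrtr_ge0 ?(ltW eps0)//.
by near: N; apply: (cvgr_lt (0 : R)) => //; exact: cvg_frobnormB.
Unshelve. all: by end_near. Qed.

(** Only the limit has to be positive definite: the Lipschitz bound needs the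
    coercivity of one of the two roots. *)
Lemma mxcvg_sqrt n (u : nat -> 'M[R]_n) B :
  (forall N, psdmx (u N)) -> posdefmx B ->
  mxcvg u B -> mxcvg (fun N => sqrtmx (u N)) (sqrtmx B).
Proof.
move=> up Bp uB; have Bpsd := posdefmx_psd Bp.
have [lam lam0 Hlam] := posdefmx_coercive
  (psdmx_unit_posdef (sqrtmx_psd Bpsd) (sqrtmx_unit Bp)).
apply: (@mxcvg_frob _ _ _ _ (fun N => (lam ^+ 2)^-1 * frobnorm (B - u N) ^+ 2)).
  rewrite -(mulr0 (lam ^+ 2)^-1); apply: cvgM; first exact: cvg_cst.
  under eq_fun do rewrite frobnorm_distC.
  exact: cvg_frobnormB.
move=> N; rewrite ler_pdivlMl ?exprn_gt0// frobnorm_distC.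
have := sqrtmx_lipschitz lam0 (sqrtmx_psd Bpsd) (sqrtmx_psd (up N)) Hlam.
by rewrite !sqrtmxK.
Qed.

Lemma mxcvg_invsqrt n (u : nat -> 'M[R]_n) B :
  (forall N, posdefmx (u N)) -> posdefmx B ->
  mxcvg u B -> mxcvg (fun N => invsqrtmx (u N)) (invsqrtmx B).
Proof.
move=> up Bp uB; apply: mxcvg_inv => [N||]; [exact: sqrtmx_unit|exact: sqrtmx_unit|].
by apply: mxcvg_sqrt => // N; exact: posdefmx_psd.
Qed.

End Convergence.

(** * Probability of countable combinations of events *)

Section Random.
Context {R : realType} {disp : measure_display} {Omega : measurableType disp}.
Variable P : probability Omega R.

Lemma countable_bigcapT_measurable d (T : measurableType d) (I : countType)
    (F : I -> set T) :
  (forall i, measurable (F i)) -> measurable (\bigcap_i F i).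
Proof.
move=> Fm; rewrite -[\bigcap_i F i]setCK setC_bigcap; apply: measurableC.
apply: countable_bigcupT_measurable => [|i]; first exact: countableP.
exact/measurableC/Fm.
Qed.

Lemma sigma_mx_measurable m n (X : Omega -> 'M[R]_(m, n)) :
  random_mx X -> sigma_mx X `<=` measurable.
Proof.
move=> Xm; apply: smallest_sub; first exact: sigma_algebra_measurable.
move=> _ [i [j [U mU ->]]]; rewrite -[X in measurable X]setTI.
exact: Xm.
Qed.

(** The sample space with the sigma-algebra generated by [X], so that the
    closure properties of measurable sets and functions apply to
    [sigma_mx X]. *)
Definition sigma_gen m n (X : Omega -> 'M[R]_(m, n)) :=
  g_sigma_algebraType
    [set E | exists i j, exists2 U : set R,
                 measurable U & E = [set w | U (X w i j)]].

Lemma sigma_gen_entry m n (X : Omega -> 'M[R]_(m, n)) i j :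
  measurable_fun setT (fun w : sigma_gen X => X w i j).
Proof.
move=> _ U mU; rewrite setTI; apply: sub_sigma_algebra.
by exists i, j, U.
Qed.

(** A countable version of conditioning: the cells [idx @^-1` [set i]]
    partition the space, and [F i] has conditional probability at least [p] on
    the cell of [i]. *)
Lemma probability_countable_cover (I : countType) (idx : Omega -> I)
    (F : I -> set Omega) (p : R) : 0 <= p ->
  (forall i, measurable (idx @^-1` [set i])) -> (forall i, measurable (F i)) ->
  (forall i, p%:E * P (idx @^-1` [set i]) <= P (idx @^-1` [set i] `&` F i))%E ->
  measurable [set w | F (idx w) w] /\ (p%:E <= P [set w | F (idx w) w])%E.
Proof.
move=> p0 idxm Fm PF.
(* pickle_inv enumerates the cells by natural numbers, each one once *)
pose cell (G : I -> set Omega) (n : nat) : set Omega :=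
  if pickle_inv n is Some i then idx @^-1` [set i] `&` G i else set0.
have cellm G : (forall i, measurable (G i)) -> forall n, measurable (cell G n).
  move=> Gm n; rewrite /cell; case: pickle_inv => // i.
  by apply: measurableI; [exact: idxm|exact: Gm].
have cellU G : \bigcup_n cell G n = [set w | G (idx w) w].
  apply/seteqP; split=> [w [n _]|w Gw].
    by rewrite /cell; case: pickle_inv => // i [/= <-].
  by exists (pickle (idx w)) => //; rewrite /cell pickleK_inv.
have cellT G : trivIset setT (cell G).
  move=> n1 n2 _ _ [w []]; rewrite /cell.
  have := @pickle_invK I n2; have := @pickle_invK I n1.
  case: (pickle_inv n1) => [i1|//]; case: (pickle_inv n2) => [i2|//] /= <- <-.
  by move=> [/= <- _] [/= <- _].
have PT : P (\bigcup_n cell (fun=> setT) n) = 1%E.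
  by rewrite cellU -[RHS](@probability_setT _ _ _ P); congr (P _); apply/seteqP.
rewrite -(cellU F); split; first by apply: bigcup_measurable => n _; exact: cellm.
rewrite -[p%:E]mule1 -PT !measure_bigcup//; try by move=> n _; exact: cellm.
rewrite -nneseriesZl//; apply: lee_nneseries => [n _ _|n _].
  by rewrite mule_ge0.
rewrite /cell; case: pickle_inv => [i|]; last by rewrite measure0 mule0.
by rewrite setIT; exact: PF.
Qed.

Lemma probability_limsup_ge (E : nat -> set Omega) (p : R) :
  (forall n, measurable (E n)) -> (forall n, p%:E <= P (E n))%E ->
  measurable (lim_sup_set E) /\ (p%:E <= P (lim_sup_set E))%E.
Proof.
move=> Em Ep; split.
  by apply: bigcapT_measurable => n; exact: bigcup_measurable.
apply: (cvge_to_ge (lim_sup_set_cvg P E Em _)).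
  by rewrite (le_lt_trans (probability_le1 _ _)) ?ltry//; exact: bigcup_measurable.
apply: nearW => n; apply: le_trans (Ep n) _.
apply: le_measure; rewrite ?inE//; first exact: bigcup_measurable.
by move=> w Ew; exists n => /=.
Qed.

Lemma with_probS (p : R) (Q Q' : set Omega) :
  Q `<=` Q' -> with_prob P p Q -> with_prob P p Q'.
Proof. by move=> QQ' [E [Em pE EQ]]; exists E; split=> // w /EQ/QQ'. Qed.

Lemma with_probI (a b : R) (Q Q' : set Omega) :
  with_prob P (1 - a) Q -> with_prob P (1 - b) Q' ->
  with_prob P (1 - (a + b)) (Q `&` Q').
Proof.
move=> [E [Em pE EQ]] [E' [E'm pE' EQ']]; exists (E `&` E'); split.
- exact: measurableI.
- have DI : P E = (P (E `\` E') + P (E `&` E'))%E by exact: measureDI.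
  have DC : (P (E `\` E') <= 1 - P E')%E.
    by rewrite -probability_setC//; apply: le_measure => [||w []//]; rewrite ?inE;
      [exact: measurableD|exact: measurableC].
  have mD := measurableD Em E'm; have mI := measurableI _ _ Em E'm.
  have Pfin X : measurable X -> exists x : R, P X = x%:E.
    by move=> mX; exists (fine (P X)); rewrite fineK// fin_num_measure.
  have [[e eE] [e' eE']] := (Pfin _ Em, Pfin _ E'm).
  have [[x xE] [y yE]] := (Pfin _ mD, Pfin _ mI).
  move: pE pE' DI DC; rewrite eE eE' xE yE.
  rewrite -EFinD -EFinB !lee_fin => h1 h2 [h3] h4; lra.
- by move=> w [/EQ ? /EQ' ?].
Qed.

Lemma with_prob_bigcap (T : nat) (Q : nat -> set Omega) (delta : R) :
  (0 < T)%N ->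
  (forall t, (t < T)%N -> with_prob P (1 - delta / T%:R) (Q t)) ->
  with_prob P (1 - delta) [set w | forall t, (t < T)%N -> Q t w].
Proof.
move=> T0 QT.
suff H n : (n <= T)%N -> with_prob P (1 - delta / T%:R *+ n)
    [set w | forall t, (t < n)%N -> Q t w].
  have := H T (leqnn T); rewrite -mulr_natr divfK// pnatr_eq0 -lt0n//.
elim: n => [_|n IH nT].
  by exists setT; split => //; rewrite mulr0n subr0 probability_setT.
rewrite mulrSr; apply: with_probS (with_probI (IH (ltnW nT)) (QT _ nT)).
move=> w [/= Qn Qw] t; rewrite ltnS leq_eqVlt => /predU1P[->//|].
exact: Qn.
Qed.

End Random.

Section Rounding.
Variable R : realType.

(** Indices of the cells, of mesh [1 / (N + 1)], of a grid of matrices. *)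
Definition round_mx m n N (X : 'M[R]_(m, n)) : 'M[int]_(m, n) :=
  \matrix_(i, j) Num.floor (X i j * N.+1%:R).

Lemma round_mx_dist m n N (X X' : 'M[R]_(m, n)) i j :
  round_mx N X = round_mx N X' -> `|X i j - X' i j| <= N.+1%:R^-1.
Proof.
move=> /matrixP/(_ i j); rewrite !mxE => XX'.
have := floor_itv (X i j * N.+1%:R); have := floor_itv (X' i j * N.+1%:R).
rewrite XX' intrD; set a := _%:~R => /andP[h1 h2] /andP[h3 h4].
rewrite -[_^-1]mul1r ler_pdivlMr// -[X in _ * X]ger0_norm// -normrM mulrBl.
by rewrite ler_norml; apply/andP; split; lra.
Qed.

Lemma mxcvg_round m n (u : nat -> 'M[R]_(m, n)) B (N : nat -> nat) :
  (forall i, (i <= N i)%N) ->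
  (forall i, round_mx (N i) (u i) = round_mx (N i) B) -> mxcvg u B.
Proof.
move=> iN uB i j; apply/cvgrPdist_le => eps eps0.
near=> M; rewrite distrC (le_trans (round_mx_dist _ _ (uB M)))//.
apply: le_trans (_ : M.+1%:R^-1 <= _).
  by rewrite lef_pV2 ?posrE// ler_nat ltnS.
near: M; have := @cvg_harmonic R => /cvgrPdist_le/(_ _ eps0).
apply: filterS => M /=; rewrite sub0r normrN ger0_norm// invr_ge0.
Unshelve. all: by end_near. Qed.

End Rounding.

(** * Sketching a random matrix *)

Section SketchEvent.
Context {R : realType} {disp : measure_display} {Omega : measurableType disp}.
Variable P : probability Omega R.

Definition grid_mx m n N (q : 'M[int]_(m, n)) : 'M[R]_(m, n) :=
  \matrix_(i, j) ((q i j)%:~R / N.+1%:R).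

Lemma round_grid_mx m n N (q : 'M[int]_(m, n)) : round_mx N (grid_mx N q) = q.
Proof.
by apply/matrixP => i j; rewrite !mxE divfK ?pnatr_eq0// intrKfloor.
Qed.

Lemma sketch_ok_closed d l (S : 'M[R]_(d, l)) (B : nat -> 'M[R]_d) B'
    (z : nat -> 'cV[R]_d) z' gamma k :
  mxcvg B B' -> mxcvg z z' ->
  (forall N, `|dotv (S^T *m (B N *m z N)) (S^T *m (B N *m z N))
               - dotv (B N *m z N) (B N *m z N)|
     <= gamma * (specnorm (B N) ^+ 2 + frobnorm (B N) ^+ 2 / k)
        * dotv (z N) (z N)) ->
  `|dotv (S^T *m (B' *m z')) (S^T *m (B' *m z'))
    - dotv (B' *m z') (B' *m z')|
  <= gamma * (specnorm B' ^+ 2 + frobnorm B' ^+ 2 / k) * dotv z' z'.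
Proof.
move=> BB' zz' h.
have Bz := mxcvgM BB' zz'; have SBz := mxcvgM (@mxcvg_cst _ _ _ S^T) Bz.
pose dev (C : 'M[R]_d) x := dotv (S^T *m (C *m x)) (S^T *m (C *m x))
  - dotv (C *m x) (C *m x).
have lhs : (fun N => `|dev (B N) (z N)|) @ \oo --> `|dev B' z'|.
  by apply: cvg_norm; apply: cvgB; exact: cvg_dotv.
have spec2 : (fun N => specnorm (B N) ^+ 2) @ \oo --> specnorm B' ^+ 2.
  rewrite expr2; under eq_fun do rewrite expr2.
  by apply: cvgM; exact: cvg_specnorm.
pose size2 (C : 'M[R]_d) := specnorm C ^+ 2 + frobnorm C ^+ 2 / k.
have rhs : (fun N => gamma * size2 (B N) * dotv (z N) (z N)) @ \oo -->
    gamma * size2 B' * dotv z' z'.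
  apply: cvgM; last exact: cvg_dotv.
  apply: cvgM; first exact: cvg_cst.
  by apply: cvgD => //; apply: cvgM; [exact: cvg_frobnorm_sq|exact: cvg_cst].
exact: (ler_cvg_to lhs rhs (nearW _ h)).
Qed.

Lemma sketch_ok_gridP d l (S : 'M[R]_(d, l)) (B : 'M[R]_d) gamma k :
  (forall q : nat * 'cV[int]_d, let z := grid_mx q.1 q.2 in
    `|dotv (S^T *m (B *m z)) (S^T *m (B *m z)) - dotv (B *m z) (B *m z)|
    <= gamma * (specnorm B ^+ 2 + frobnorm B ^+ 2 / k) * dotv z z) ->
  sketch_ok S B gamma k.
Proof.
move=> h z.
apply: (@sketch_ok_closed _ _ _ (fun=> B) _
  (fun N => grid_mx N (round_mx N z))) => [||N].
- exact: mxcvg_cst.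
- by apply: (mxcvg_round (N := id)) => // N; rewrite round_grid_mx.
- exact: (h (N, round_mx N z)).
Qed.

(** By continuity in [z] the guarantee is a countable conjunction, over the
    [z] on the grids, of inequalities between measurable functions. *)
Lemma sketch_event_measurable d l (S : Omega -> 'M[R]_(d, l)) B gamma k :
  sigma_mx S [set w | sketch_ok (S w) B gamma k].
Proof.
pose ev (q : nat * 'cV[int]_d) := [set w : sigma_gen S |
  `|dotv ((S w)^T *m (B *m grid_mx q.1 q.2)) ((S w)^T *m (B *m grid_mx q.1 q.2))
    - dotv (B *m grid_mx q.1 q.2) (B *m grid_mx q.1 q.2)|
  <= gamma * (specnorm B ^+ 2 + frobnorm B ^+ 2 / k)
     * dotv (grid_mx q.1 q.2 : 'cV[R]_d) (grid_mx q.1 q.2)].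
rewrite (_ : [set w | _] = \bigcap_q ev q); last first.
  apply/seteqP; split=> [w Sw q _|w Sw]; first exact: Sw.
  by apply: sketch_ok_gridP => q; exact: Sw.
apply: (@countable_bigcapT_measurable _ (sigma_gen S)) => q.
rewrite /ev; set v := B *m _; set c := dotv v v; set r := _ * dotv _ _.
have mf : measurable_fun setT
    (fun w : sigma_gen S => `|dotv ((S w)^T *m v) ((S w)^T *m v) - c|).
  suff mq : measurable_fun setT (fun w : sigma_gen S =>
      dotv ((S w)^T *m v) ((S w)^T *m v)).
    by apply: measurableT_comp => //; exact: measurable_funB.
  under [X in measurable_fun _ X]eq_fun do rewrite dotvE.
  apply: measurable_sum => j.
  suff mj : measurable_fun setT (fun w : sigma_gen S => ((S w)^T *m v) j 0).
    exact: measurable_funM.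
  under [X in measurable_fun _ X]eq_fun do rewrite mxE.
  apply: measurable_sum => i; under [X in measurable_fun _ X]eq_fun do rewrite mxE.
  by apply: measurable_funM => //; exact: sigma_gen_entry.
have := mf measurableT _ (measurable_itv `]-oo, r]).
by rewrite setTI set_itvE.
Qed.

Lemma round_event_measurable m n (Y : Omega -> 'M[R]_(m, n)) N q :
  sigma_mx Y [set w | round_mx N (Y w) = q].
Proof.
pose ev (ij : 'I_m * 'I_n) := [set w : sigma_gen Y |
  Num.floor (Y w ij.1 ij.2 * N.+1%:R) = q ij.1 ij.2].
rewrite (_ : [set w | _] = \bigcap_ij ev ij); last first.
  apply/seteqP; split=> [w /= wq ij _|w h]; first by rewrite /ev/= -wq mxE.
  by apply/matrixP => i j; rewrite mxE; exact: (h (i, j)).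
apply: (@countable_bigcapT_measurable _ (sigma_gen Y)) => -[i j].
have mf : measurable_fun setT (fun w : sigma_gen Y => Y w i j * N.+1%:R).
  by apply: measurable_funM => //; exact: sigma_gen_entry.
have := mf measurableT _ (measurable_itv `[(q i j)%:~R, (q i j + 1)%:~R[).
rewrite setTI; congr (measurable _); apply/seteqP.
split => w /=; rewrite in_itv/=; first by move=> h; exact: floor_def.
by move=> <-; exact: floor_itv.
Qed.

(** The guarantee is given for each fixed matrix, so it extends at once, by
    independence, to a matrix that takes countably many values determined by
    [Y].  Rounding [Y] to a grid of mesh [1 / (N + 1)] and replacing [B] by its
    value at a representative of each cell gives such a matrix, and an event
    [E N] of probability at least [1 - delta].  On the upper limit of the [E N],
    whose probability is at least [1 - delta] too, the guarantee holds at representatives that tend to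
    the actual [Y], hence at the actual [B] by continuity.

    Continuity of [B] may fail across the set [G]: its indicator is added to the
    index of the cells.  The
    representatives are sample points, so that [B] has to make sense only at
    the values that [Y] takes. *)
Lemma sketch_ok_random d l m n (S : Omega -> 'M[R]_(d, l))
    (Y : Omega -> 'M[R]_(m, n)) (B : Omega -> 'M[R]_d) (G : set Omega)
    (gamma k delta : R) :
  sketching_mx P S gamma k delta -> random_mx Y -> indep_mx P S Y ->
  sigma_mx Y G ->
  (forall w (v : nat -> Omega), (forall N, G (v N) <-> G w) ->
     mxcvg (fun N => Y (v N)) (Y w) -> mxcvg (fun N => B (v N)) (B w)) ->
  with_prob P (1 - delta) [set w | sketch_ok (S w) (B w) gamma k].
Proof.
move=> [Sm Ssk] Ym SY GY Bcont.
(* the bound on products of probabilities needs 0 <= 1 - delta *)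
have [d1|d1] := leP (1 - delta) 0.
  exists set0; split => //; first by rewrite measure0 lee_fin.
pose idx N w := (round_mx N (Y w), `[< G w >]).
have idxY N j : sigma_mx Y (idx N @^-1` [set j]).
  case: j => q b.
  rewrite (_ : _ @^-1` _ = [set w | round_mx N (Y w) = q] `&`
    (if b then G else ~` G)).
    apply: (@measurableI _ (sigma_gen Y)); first exact: round_event_measurable.
    by case: b; [exact: GY|exact: (@measurableC _ (sigma_gen Y))].
  apply/seteqP; split=> w; rewrite /idx/=.
    by move=> [-> <-]; case: asboolP.
  by case: b => -[<- Gw]; congr (_, _); apply/asboolP.
pose rep N j : 'M[R]_d := xget 0 [set B w | w in idx N @^-1` [set j]].
have repP N w : exists v, idx N v = idx N w /\ B v = rep N (idx N w).
  rewrite /rep; case: xgetP => [_ -> [v vw <-]|/(_ (B w))[]]; first by exists v.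
  by exists w.
pose good B := [set w | sketch_ok (S w) B gamma k].
have good_meas B0 : measurable (good B0).
  by apply: (sigma_mx_measurable Sm); exact: sketch_event_measurable.
have goodP B0 : ((1 - delta)%:E <= P (good B0))%E.
  have [E [Em pE EB]] := Ssk B0; apply: le_trans pE _.
  apply: le_measure; rewrite ?inE// => w /EB.
  exact: specnorm_sketch_ok.
pose E N := [set w | good (rep N (idx N w)) w].
have EP N : measurable (E N) /\ ((1 - delta)%:E <= P (E N))%E.
  apply: (probability_countable_cover (F := fun j => good (rep N j))).
  - exact: ltW.
  - by move=> j; exact: (sigma_mx_measurable Ym).
  - by move=> j; exact: good_meas.
  move=> j; rewrite setIC SY//; last exact: sketch_event_measurable.
  by rewrite lee_wpmul2r.
have [limm limp] := probability_limsup_ge (fun N => (EP N).1) (fun N => (EP N).2).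
exists (lim_sup_set E); split=> // w limw.
have /choice[v vP] : forall M, exists v, exists2 N, (M <= N)%N &
    idx N v = idx N w /\ good (B v) w.
  move=> M; have [N /= MN EN] := limw M I.
  by have [v [vw Bv]] := repP N w; exists v, N => //; rewrite Bv.
have /choice[N NP] : forall M, exists N, (M <= N)%N /\ idx N (v M) = idx N w.
  by move=> M; have [N MN [vw _]] := vP M; exists N.
have Yv : mxcvg (fun M => Y (v M)) (Y w).
  by apply: (mxcvg_round (N := N)) => M; have [MN [Yvw _]] := NP M.
have Gv M : G (v M) <-> G w.
  have [_ [_ Gvw]] := NP M.
  by split=> /asboolP Gx; apply/asboolP; [rewrite -Gvw|rewrite Gvw].
move=> z; apply: (@sketch_ok_closed _ _ _ _ _ (fun=> z)).
- exact: Bcont Gv Yv.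
- exact: mxcvg_cst.
- by move=> M; have [_ _ [_]] := vP M; exact.
Qed.

End SketchEvent.

(** * Continuity of the test matrix *)

Section TestContinuity.
Variable R : realType.

Lemma boosted0 d (M : 'M[R]_d) k : boosted M 0 k = M.
Proof. by rewrite /boosted mul0mx scaler0 addr0. Qed.

(** The direction of [g] is discontinuous at [g = 0], that is at the
    minimizer, whence the last hypothesis. *)
Lemma mxcvg_test d (A : 'M[R]_d) (k rho : R) (H : nat -> 'M[R]_d) H'
    (p : nat -> 'cV[R]_d) p' :
  psdmx A -> 1 <= k -> (forall N, posdefmx (H N)) -> posdefmx H' ->
  0 < rho -> loewner (rho *: H') A ->
  mxcvg H H' -> mxcvg p p' -> (forall N, p N = 0 <-> p' = 0) ->
  mxcvg (fun N => test_mx A (H N) k (p N)) (test_mx A H' k p').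
Proof.
move=> Ap k1 Hp Hp' rho0 HA HH pp p0.
have Mu : posdefmx (scaled_hessian A H').
  exact: (scaled_hessian_posdef Ap Hp' rho0 HA).
have Mp N : psdmx (scaled_hessian A (H N)) by exact: scaled_hessian_psd.
have ZZ : mxcvg (fun N => invsqrtmx (H N)) (invsqrtmx H').
  exact: mxcvg_invsqrt.
have MM : mxcvg (fun N => scaled_hessian A (H N)) (scaled_hessian A H').
  by apply: mxcvgM => //; apply: mxcvgM => //; exact: mxcvg_cst.
rewrite /test_mx; apply: mxcvg_sqrt => [N||].
- exact: boosted_psd.
- by apply: boosted_posdef => //; exact: posdefmx_psd.
have [p'0|p'0] := eqVneq p' 0.
  rewrite p'0 !mulmx0 boosted0.
  have -> : (fun N => boosted (scaled_hessian A (H N))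
      (invsqrtmx (H N) *m (A *m p N)) k) = fun N => scaled_hessian A (H N).
    by apply/funext => N; rewrite (p0 N).2// !mulmx0 boosted0.
  exact: MM.
have gg : mxcvg (fun N => invsqrtmx (H N) *m (A *m p N))
    (invsqrtmx H' *m (A *m p')).
  by apply: mxcvgM => //; apply: mxcvgM => //; exact: mxcvg_cst.
apply: mxcvgD => //; apply: mxcvgZ; last exact: mxcvgM (mxcvg_tr gg).
apply: cvgM.
  apply: cvgD; first exact: cvg_specnorm.
  by apply: cvgM; [exact: cvg_mxtrace|exact: cvg_cst].
apply: cvgV; last by apply: cvgM; [exact: cvg_cst|exact: cvg_dotv].
rewrite mulf_neq0// gt_eqF//.
apply: lt_le_trans (gap_le Ap Hp' rho0 HA p').
rewrite mulr_gt0//; apply: lt_le_trans (loewner_quad HA p').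
by rewrite mulr_gt0// Hp'.2.
Qed.

End TestContinuity.

(** * Convergence and query complexity *)

(** [C = 60] gives [T / (30 kappa) >= 2 ln (1 / eps)], so the initial gap is
    multiplied by at most [eps ^ 2], of which one factor absorbs [D0].  The first
    bound on [eps0] forces [T >= exp 3], hence [k > ln (T / delta) >= 3].  For the
    complexity, [l <= 2 cl k] turns [kappa l] into a multiple of [kappaQ], so no
    iterated logarithm appears and the exponent [p] is [0]. *)
Theorem corollary2 (R : realType) :
  exists2 C : R, 0 < C &
  forall cl K : R, 0 < cl -> 0 < K ->
  exists2 K' : R, 0 < K' & exists p : nat,
  forall D0 : R, exists2 eps0 : R, 0 < eps0 < 1 &
  forall (d l T : nat) (phi f : 'cV[R]_d -> R) (A : 'M[R]_d)
    (x0 xstar : 'cV[R]_d) (L mu sigma alpha k delta eps : R)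
    (disp : measure_display) (Omega : measurableType disp)
    (P : probability Omega R)
    (S : nat -> Omega -> 'M[R]_(d, l)) (H : nat -> Omega -> 'M[R]_d)
    (rho : nat -> Omega -> R),
  let x := fun (t : nat) (w : Omega) =>
    zo_iter f A alpha k (fun s => H s w) (fun s => S s w) x0 t in
  let nrm := fun (t : nat) (w : Omega) =>
    specnorm (scaled_hessian A (H t w)) in
  let trc := fun (t : nat) (w : Omega) => \tr (invmx (H t w) *m A) in
  let rhomin := fun w : Omega => min_upto T (fun t => rho t w) in
  let kappa := fun w : Omega =>
    max_upto T (fun t => (rho t w)^-1 * (nrm t w + trc t w / k)) in
  let kappaQ := fun w : Omega =>
    max_upto T (fun t => (rho t w)^-1 * (nrm t w * l%:R + trc t w)) in
  (0 < T)%N ->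
  psdmx A -> 0 < L -> loewner A (L%:M) ->
  quadratic_with_hessian phi A ->
  0 < mu -> strongly_convex phi mu ->
  minimizer phi xstar ->
  phi x0 - phi xstar <= D0 ->
  0 <= sigma -> (forall y, `|f y - phi y| <= sigma) ->
  0 < alpha -> 1 <= k -> 0 < delta ->
  ln (T%:R / delta) < k ->
  l%:R <= cl * (k + ln (T%:R / delta)) ->
  (forall t, (t < T)%N -> sketching_mx P (S t) 4^-1 k (delta / T%:R)) ->
  (forall t, (t < T)%N -> random_mx (x t)) ->
  (forall t, (t < T)%N -> random_mx (H t)) ->
  (forall t, (t < T)%N ->
     indep_mx P (S t) (fun w => row_mx (x t w) (H t w))) ->
  (forall t w, (t < T)%N ->
     [/\ posdefmx (H t w), 0 < rho t w & loewner (rho t w *: H t w) A]) ->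
  0 < eps <= eps0 ->
  ((forall w, C * kappa w * ln (eps^-1) <= T%:R) ->
   with_prob P (1 - delta)
     [set w | phi (x T w) - phi xstar
              <= eps + 3 * l%:R * sigma ^+ 2 / (rhomin w * alpha ^+ 2)])
  /\
  (forall w, T%:R <= K * kappa w * ln (eps^-1) ->
   T%:R * l%:R
     <= K' * (1 + `|ln (ln (eps^-1))|) ^+ p * kappaQ w * ln (eps^-1)).
Proof.
exists 60 => // cl K cl0 K0.
exists (K * (1 + 2 * cl)); first by rewrite mulr_gt0// addr_gt0// mulr_gt0.
exists 0%N => D0; exists (Num.min (expR (- expR 3)) (1 + `|D0|)^-1).
  rewrite lt_min gt_min expR_gt0 invr_gt0 ltr_pwDl//=.
  by rewrite expR_lt1 oppr_lt0 expR_gt0.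
move=> d l T phi f A x0 xs L mu sigma alpha k delta eps disp Omega P S H rho.
move=> x nrm trc rhomin kappa kappaQ T0 Ap _ _ phiA _ _ phimin gapD0 sigma0 fphi.
move=> alpha0 k1 delta0 lnk lk Ssk xm Hm SY HP; rewrite le_min.
move=> /and3P[eps0 eps_exp eps_D0].
have k0 : 0 < k by exact: lt_le_trans k1.
have phiE := quadratic_minE Ap phiA phimin.
have ln_eps : expR 3 <= ln eps^-1.
  rewrite lnV ?posrE// lerNr -(expRK (- expR 3)).
  by rewrite ler_ln ?posrE ?expR_gt0.
have ln0 : 0 < ln eps^-1 by apply: lt_le_trans ln_eps; exact: expR_gt0.
split; last first.
  move=> w TK; rewrite expr0 mulr1.
  have trc0 t : (t < T)%N -> 0 <= trc t w.
    by move=> /(HP _ w)[Hp _ _]; exact: trace_ge0.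
  have nrm0 t : 0 <= nrm t w by exact: specnorm_ge0.
  have Qge t : (t < T)%N -> 0 <= (rho t w)^-1 * (nrm t w * l%:R + trc t w).
    move=> tT; have [_ r0 _] := HP _ w tT.
    by rewrite mulr_ge0 ?invr_ge0 ?(ltW r0)// addr_ge0 ?mulr_ge0// trc0.
  have kQ0 : 0 <= kappaQ w by apply: le_trans (Qge _ T0) (le_max_upto _ T0).
  have lk2 : l%:R <= 2 * cl * k.
    apply: le_trans lk _; have := ltW lnk; rewrite -(ler_pM2l cl0) => lnk'; lra.
  have kl : kappa w * l%:R <= (1 + 2 * cl) * kappaQ w.
    have [->|l0] := eqVneq l 0%N.
      by rewrite mulr0 mulr_ge0// addr_ge0// mulr_ge0// ltW.
    have lp : 0 < l%:R :> R by rewrite ltr0n lt0n.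
    rewrite -ler_pdivlMr//; apply: max_upto_le => // t tT.
    rewrite ler_pdivlMr//.
    apply: le_trans (_ : (1 + 2 * cl) *
      ((rho t w)^-1 * (nrm t w * l%:R + trc t w)) <= _); last first.
      rewrite ler_wpM2l//; last exact: (le_max_upto (fun t => (rho t w)^-1 *
        (nrm t w * l%:R + trc t w))).
      by rewrite addr_ge0// mulr_ge0// ltW.
    have [_ r0 _] := HP _ w tT.
    rewrite mulrCA -mulrA ler_pM2l ?invr_gt0//.
    have trl : trc t w / k * l%:R <= 2 * cl * trc t w.
      by rewrite mulrAC ler_pdivrMr// mulrAC mulrC ler_wpM2r ?trc0.
    have := mulr_ge0 (ltW cl0) (mulr_ge0 (nrm0 t) (ltW lp)).
    by have := trc0 _ tT; lra.
  apply: le_trans (ler_wpM2r (ler0n _ l) TK) _.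
  rewrite mulrAC ler_pM2r// -!mulrA ler_pM2l//.
move=> TC.
have [delta1|delta1] := leP 1 delta.
  by exists set0; split=> //; rewrite measure0 lee_fin subr_le0.
have rhom0 w : 0 < rhomin w by apply: min_upto_gt0 => // t /(HP _ w)[].
(* in dimension 0 the lower bound kappa >= 1 fails, but every gap is 0 *)
case: (posnP d) => [d0|d0].
  exists setT; split=> // [|w _ /=].
    by rewrite probability_setT lee_fin lerBlDr lerDl ltW.
  have -> : x T w = xs by apply/matrixP => i; have := ltn_ord i; rewrite {2}d0.
  rewrite subrr addr_ge0 ?(ltW eps0)//.
  by rewrite divr_ge0// mulr_ge0 ?sqr_ge0 ?mulr_ge0// ltW.
have Sgood t : (t < T)%N -> with_prob P (1 - delta / T%:R)
    [set w | sketch_ok (S t w) (test_mx A (H t w) k (x t w - xs)) 4^-1 k].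
  move=> tT.
  have Yl : forall w i, row_mx (x t w) (H t w) i (lshift d 0) = x t w i 0.
    by move=> w i; rewrite row_mxEl.
  have Yr : forall w i j, row_mx (x t w) (H t w) i (rshift 1 j) = H t w i j.
    by move=> w i j; rewrite row_mxEr.
  apply: (sketch_ok_random (Y := fun w => row_mx (x t w) (H t w))
    (G := [set w | x t w = xs])) => //.
  - exact: Ssk.
  - move=> i j; case: (split_ordP j) => j' ->.
      by rewrite ord1; under [X in measurable_fun _ X]eq_fun do rewrite Yl;
        exact: xm.
    by under [X in measurable_fun _ X]eq_fun do rewrite Yr; exact: Hm.
  - exact: SY.
  - rewrite (_ : [set w | _] = \bigcap_(i : 'I_d) [set w |
        [set xs i 0] (row_mx (x t w) (H t w) i (lshift d 0))]); last first.
      apply/seteqP; split=> [w /= xE i _|w xE]; first by rewrite /= Yl xE.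
      by apply/matrixP => i j; rewrite ord1 -Yl; exact: xE.
    apply: (@countable_bigcapT_measurable _
      (sigma_gen (fun w => row_mx (x t w) (H t w)))) => i.
    by apply: sub_sigma_algebra; exists i, (lshift d 0), [set xs i 0].
  move=> w v Gv Yv.
  have [Hp r0 HA] := HP _ w tT.
  apply: mxcvg_test HA _ _ _ => //.
  - by move=> N; have [] := HP _ (v N) tT.
  - by move=> i j; have := Yv i (rshift 1 j); rewrite Yr; under eq_fun do rewrite Yr.
  - apply: mxcvgB; last exact: mxcvg_cst.
    by move=> i j; rewrite ord1; have := Yv i (lshift d 0); rewrite Yl;
      under eq_fun do rewrite Yl.
  have sub0 u : x t u - xs = 0 <-> x t u = xs.
    by split=> [/eqP|->]; rewrite ?subrr// subr_eq0 => /eqP.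
  by move=> N; split=> /sub0 h; apply/sub0; [exact: (Gv N).1|exact: (Gv N).2].
apply: with_probS (with_prob_bigcap T0 Sgood) => w /= Sw.
have kap1 : 1 <= kappa w.
  by apply: kappa_ge1 => // t tT; exact: HP.
have kap0 : 0 < kappa w by exact: lt_le_trans kap1.
have Tln := TC w.
have k3 : 3 <= k.
  apply: ltW; apply: le_lt_trans lnk; rewrite -[leLHS]expRK ler_ln ?posrE ?expR_gt0//.
    apply: le_trans ln_eps _; rewrite ler_pdivlMr//.
    apply: le_trans (_ : ln eps^-1 <= _); first by rewrite ler_piMr ?ltW.
    by apply: le_trans Tln; rewrite ler_peMl ?ltW//; lra.
  by rewrite divr_gt0// ltr0n.
have := @zo_iter_gap R d l T phi f A x0 xs sigma alpha k (fun s => H s w)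
  (fun s => S s w) (fun s => rho s w) T0 d0 Ap phiE sigma0 fphi alpha0 k0.
move=> /(_ (fun t => HP t w) Sw k3) /le_trans; apply.
rewrite -/(kappa w) -/(rhomin w) addrC; apply: lerD; last first.
  rewrite le_eqVlt; apply/orP; left; apply/eqP; field.
  by rewrite !gt_eqF.
have expT : expR (- (T%:R * (30 * kappa w)^-1)) <= eps ^+ 2.
  rewrite -[in leRHS](lnK (x := eps)) ?posrE// -expRM_natr ler_expR lerNl.
  rewrite -mulNr -lnV ?posrE// ler_pdivlMr ?mulr_gt0//.
  by apply: le_trans Tln; rewrite le_eqVlt; apply/orP; left; apply/eqP; ring.
have gap0 : 0 <= phi x0 - phi xs by rewrite subr_ge0.
apply: le_trans (ler_wpM2r gap0 expT) _.
rewrite expr2 -mulrA ler_piMr ?(ltW eps0)//.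
have D0_1 : eps * (1 + `|D0|) <= 1.
  by rewrite -ler_pdivlMr ?div1r// ltr_pwDl.
apply: le_trans D0_1; rewrite ler_pM2l//.
by apply: le_trans gapD0 (le_trans (ler_norm _) _); rewrite lerDr.
Qed.
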